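(* Let $C$ be the Cartan matrix of one of the following finite types: $A_n$ with $n\in\{1,2,3,4,5,6\}$; $D_n$ with $n\in\{5,6,7,8\}$; $E_n$ with $n\in\{6,7,8\}$. Then $\eta$ induces an isomorphism of groups $$\eta:\mathcal{P}\mathcal{V}^{+}(\mathcal{O})=\mathcal{V}^{+}(\mathcal{O})/\{\pm 1\}\stackrel{\simeq}{\longrightarrow}\mathcal{W}(C^{++}),$$ where $\mathcal{W}(C^{++})$ is the Weyl group of the canonical Lorentzian extension of $C$ (of type $A_n^{++}$, $D_n^{++}$, $E_n^{++}$ respectively).
   Context: Conventions. An orthogonal geometry over a field $F$ (char $\neq 2$) is a finite-dimensional $F$-vector space with a symmetric bilinear form $S$; write $q(v)=S(v,v)$. $O(V)$ is the isometry group; for $q(v)\ne0$, $r_v(w)=w-2\frac{S(w,v)}{S(v,v)}v$. For $V$ non-singular, $\mathcal{C}(V)$ is the universal Clifford algebra with the sign convention $v^2=-q(v)$; $V$ and $F$ are viewed inside $\mathcal{C}(V)$. $x\mapsto x'$ is the algebra automorphism of $\mathcal{C}(V)$ with $v'=-v$ for $v\in V$; $x\mapsto x^*$ is the anti-automorphism with $v^*=v$ for $v\in V$; $\bar x=(x^* )'$. $\Gamma(V)=\{x\in\mathcal{C}(V)^\times : xV(x')^{-1}\subseteq V\}$. Lie data. Let $C=(c_{ij})$ be the ($n\times n$, symmetric) Cartan matrix of the given type, $F=\mathbb{Q}$, $V=\mathbb{Q}^n$ with standard basis $(\alpha_1,\dots,\alpha_n)$ and form $\kappa(\alpha_i,\alpha_j)=c_{ij}$.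 $\theta$ is the highest root (of the finite root system with simple roots $\alpha_i$), so $\kappa(\theta,\theta)=2$. $V^{1/2}$ denotes $V$ with the rescaled form $\frac12\kappa$. $P$ is a hyperbolic plane over $\mathbb{Q}$ with basis $f_1,f_2$ of isotropic vectors such that $S(f_1,f_2)=-\frac12$, and $W=V^{1/2}\perp P$. Vahlen groups. There is a $\mathbb{Q}$-algebra isomorphism $\phi:\mathcal{C}(W)\to M_2(\mathcal{C}(V^{1/2}))$ with $\phi(v+\lambda_1f_1+\lambda_2f_2)=\begin{pmatrix}v&\lambda_1\\ \lambda_2&\bar v\end{pmatrix}$. Put $\mathcal{V}(V^{1/2})=\phi(\Gamma(W))$ and $H_2(V^{1/2})=\phi(W)=\left\{\begin{pmatrix}v&\lambda_1\\ \lambda_2&\bar v\end{pmatrix}: v\in V^{1/2},\lambda_i\in\mathbb{Q}\right\}$, an orthogonal geometry with quadratic form $Q(X)=v\bar v-\lambda_1\lambda_2$. For $A=\begin{pmatrix}a&b\\c&d\end{pmatrix}\in M_2(\mathcal{C}(V^{1/2}))$ let $\alpha(A)=\begin{pmatrix}a'&-b'\\-c'&d'\end{pmatrix}$ and $\gamma(A)=\begin{pmatrix}d^*&-b^*\\-c^*&a^*\end{pmatrix}$. For $A\in\mathcal{V}(V^{1/2})$, $A\gamma(A)$ is a nonzero rational scalar, denoted $N(A)$; $\mathcal{V}^+(V^{1/2})=\{A\in\mathcal{V}(V^{1/2}):N(A)=1\}$. The group $\mathcal{V}(V^{1/2})$ acts on $H_2(V^{1/2})$ by $\eta(A)(X)=AX\alpha(A)^{-1}$,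 giving a homomorphism $\eta:\mathcal{V}(V^{1/2})\to O(H_2(V^{1/2}))$. $\mathcal{O}=\mathbb{Z}[\alpha_1,\dots,\alpha_n]\subseteq\mathcal{C}(V^{1/2})$ is the subring generated by the $\alpha_i$, and $\mathcal{V}^+(\mathcal{O})=\mathcal{V}^+(V^{1/2})\cap M_2(\mathcal{O})^\times$. Canonical Lorentzian extension. Let $X_{-1}=\begin{pmatrix}0&1\\-1&0\end{pmatrix}$, $X_0=\begin{pmatrix}-\theta&-1\\0&-\bar\theta\end{pmatrix}$, $X_i=\begin{pmatrix}\alpha_i&0\\0&\bar\alpha_i\end{pmatrix}$ for $1\le i\le n$ (the images under $\phi$ of $f_1-f_2$, $-f_1-\theta$, $\alpha_i$). These form a basis of $H_2(V^{1/2})$ and $C^{++}$ is the Cartan matrix with entries $2S(X_i,X_j)/S(X_i,X_i)$, where $S$ is the symmetric bilinear form of $Q$. The Weyl group $\mathcal{W}(C^{++})$ is the subgroup of $O(H_2(V^{1/2}))$ generated by the reflections $r_{X_i}$, $i=-1,0,1,\dots,n$. *)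

(* Defs.v *)
From HB Require Import structures.
From mathcomp Require Import all_boot all_order all_algebra.
From mathcomp Require Import ring boolp.

Set Implicit Arguments.
Unset Strict Implicit.
Unset Printing Implicit Defensive.

Import GRing.Theory.

Local Open Scope ring_scope.
Local Open Scope quotient_scope.

(* Any ring gets a classical [unitRingType] structure: [x^-1] is the inverse
   when [x] is invertible, and [x] otherwise. *)
Section ClassicalUnits.
Variable R : nzRingType.

Definition cunit (x : R) : bool := `[< exists y, y * x = 1 /\ x * y = 1 >].

Definition cinv (x : R) : R :=
  if pselect (exists y, y * x = 1 /\ x * y = 1) is left e
  then projT1 (cid e) else x.

Lemma cmulVr : {in cunit, left_inverse 1 cinv *%R}.
Proof.
by move=> x /asboolP e; rewrite /cinv; case: pselect => // e'; case: cid => y [].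
Qed.

Lemma cmulrV : {in cunit, right_inverse 1 cinv *%R}.
Proof.
by move=> x /asboolP e; rewrite /cinv; case: pselect => // e'; case: cid => y [].
Qed.

Lemma cunitP (x y : R) : y * x = 1 /\ x * y = 1 -> cunit x.
Proof. by move=> h; apply/asboolP; exists y. Qed.

Lemma cinv_out : {in [predC cunit], cinv =1 id}.
Proof. by move=> x /asboolP h; rewrite /cinv; case: pselect. Qed.

End ClassicalUnits.

(* 2 x 2 matrices over an F-algebra, as an F-algebra.  ([matrix] alone is a
   module over its own coefficient ring.) *)
Definition M2 (F : fieldType) (A : algType F) : Type := 'M[A]_2.

Section M2Algebra.
Variables (F : fieldType) (A : algType F).

HB.instance Definition _ := GRing.NzRing.copy (M2 A) 'M[A]_2.

Definition M2_scale (k : F) (X : M2 A) : M2 A :=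
  map_mx (fun x : A => k *: x) X.

Lemma M2_scalerA a b X : M2_scale a (M2_scale b X) = M2_scale (a * b) X.
Proof. by apply/matrixP => i j; rewrite !mxE scalerA. Qed.
Lemma M2_scale1r : left_id 1 M2_scale.
Proof. by move=> X; apply/matrixP => i j; rewrite !mxE scale1r. Qed.
Lemma M2_scalerDr : right_distributive M2_scale +%R.
Proof. by move=> k X Y; apply/matrixP => i j; rewrite !mxE scalerDr. Qed.
Lemma M2_scalerDl X : {morph M2_scale^~ X : a b / a + b}.
Proof. by move=> a b; apply/matrixP => i j; rewrite !mxE scalerDl. Qed.

HB.instance Definition _ := GRing.Zmodule_isLmodule.Build F (M2 A)
  M2_scalerA M2_scale1r M2_scalerDr M2_scalerDl.

Lemma M2_scalerAl (k : F) (X Y : M2 A) : k *: (X * Y) = (k *: X) * Y.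
Proof.
apply/matrixP => i j; rewrite !mxE scaler_sumr.
by apply: eq_bigr => l _; rewrite !mxE scalerAl.
Qed.
HB.instance Definition _ :=
  GRing.Lmodule_isLalgebra.Build F (M2 A) M2_scalerAl.

Lemma M2_scalerAr (k : F) (X Y : M2 A) : k *: (X * Y) = X * (k *: Y).
Proof.
apply/matrixP => i j; rewrite !mxE scaler_sumr.
by apply: eq_bigr => l _; rewrite !mxE scalerAr.
Qed.
HB.instance Definition _ :=
  GRing.Lalgebra_isAlgebra.Build F (M2 A) M2_scalerAr.

HB.instance Definition _ := GRing.NzRing_hasMulInverse.Build (M2 A)
  (@cmulVr (M2 A)) (@cmulrV (M2 A)) (@cunitP (M2 A)) (@cinv_out (M2 A)).

Definition mx2 (a b c d : A) : M2 A :=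
  \matrix_(i < 2, j < 2)
    if i == 0 then (if j == 0 then a else b) else (if j == 0 then c else d).

Lemma M2P (X Y : M2 A) :
  X 0 0 = Y 0 0 -> X 0 1 = Y 0 1 -> X 1 0 = Y 1 0 -> X 1 1 = Y 1 1 -> X = Y.
Proof.
move=> h00 h01 h10 h11; apply/matrixP => i j.
have o2 (k : 'I_2) : (k = 0) \/ (k = 1).
  by case: k => [[|[|//]] p]; [left|right]; apply/val_inj.
by case: (o2 i) => ->; case: (o2 j) => ->.
Qed.

Lemma mx2E a b c d : ((mx2 a b c d 0 0 = a) * (mx2 a b c d 0 1 = b)
  * (mx2 a b c d 1 0 = c) * (mx2 a b c d 1 1 = d))%type.
Proof. by rewrite !mxE. Qed.

Lemma mx2_eta (X : M2 A) : X = mx2 (X 0 0) (X 0 1) (X 1 0) (X 1 1).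
Proof. by apply: M2P; rewrite mx2E. Qed.

Lemma M2_mulE (X Y : M2 A) i j : (X * Y) i j = X i 0 * Y 0 j + X i 1 * Y 1 j.
Proof.
rewrite mxE big_ord_recl big_ord1; congr (_ * _ + _ * _);
  by congr (fun_of_matrix _ _ _); apply/val_inj.
Qed.

Lemma M2_addE (X Y : M2 A) i j : (X + Y) i j = X i j + Y i j.
Proof. exact: mxE. Qed.
Lemma M2_scaleE (k : F) (X : M2 A) i j : (k *: X) i j = k *: X i j.
Proof. exact: mxE. Qed.
Lemma M2_oppE (X : M2 A) i j : (- X) i j = - X i j.
Proof. exact: mxE. Qed.
Lemma M2_1E : (1 : M2 A) = mx2 1 0 0 1.
Proof. by apply: M2P; rewrite mx2E mxE. Qed.

Lemma mul_mx2 a b c d a' b' c' d' :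
  mx2 a b c d * mx2 a' b' c' d' =
  mx2 (a * a' + b * c') (a * b' + b * d') (c * a' + d * c') (c * b' + d * d').
Proof. by apply: M2P; rewrite M2_mulE !mx2E. Qed.

Lemma add_mx2 a b c d a' b' c' d' :
  mx2 a b c d + mx2 a' b' c' d' = mx2 (a + a') (b + b') (c + c') (d + d').
Proof. by apply: M2P; rewrite M2_addE !mx2E. Qed.

Lemma scale_mx2 k a b c d :
  k *: mx2 a b c d = mx2 (k *: a) (k *: b) (k *: c) (k *: d).
Proof. by apply: M2P; rewrite M2_scaleE !mx2E. Qed.

End M2Algebra.

(* The universal Clifford algebra of an orthogonal geometry, with
   v ^ 2 = - S v v: formal expressions modulo the smallest congruence that
   makes them an associative unital F-algebra in which [V] embeds linearly and
   satisfies the Clifford relation. *)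
Section Clifford.
Variables (F : fieldType) (V : vectType F) (S : {symmetric V}).

Inductive cterm :=
| TVec of V
| TScal of F
| TAdd of cterm & cterm
| TMul of cterm & cterm.

HB.instance Definition _ := gen_eqMixin cterm.
HB.instance Definition _ := gen_choiceMixin cterm.

Inductive ceq : cterm -> cterm -> Prop :=
| ceq_refl x : ceq x x
| ceq_sym x y : ceq x y -> ceq y x
| ceq_trans x y z : ceq x y -> ceq y z -> ceq x z
| ceq_add x x' y y' : ceq x x' -> ceq y y' -> ceq (TAdd x y) (TAdd x' y')
| ceq_mul x x' y y' : ceq x x' -> ceq y y' -> ceq (TMul x y) (TMul x' y')
| ceq_addA x y z : ceq (TAdd x (TAdd y z)) (TAdd (TAdd x y) z)
| ceq_addC x y : ceq (TAdd x y) (TAdd y x)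
| ceq_add0 x : ceq (TAdd (TScal 0) x) x
| ceq_addN x : ceq (TAdd (TMul (TScal (-1)) x) x) (TScal 0)
| ceq_mulA x y z : ceq (TMul x (TMul y z)) (TMul (TMul x y) z)
| ceq_mul1l x : ceq (TMul (TScal 1) x) x
| ceq_mul1r x : ceq (TMul x (TScal 1)) x
| ceq_mulDl x y z : ceq (TMul (TAdd x y) z) (TAdd (TMul x z) (TMul y z))
| ceq_mulDr x y z : ceq (TMul x (TAdd y z)) (TAdd (TMul x y) (TMul x z))
| ceq_scalD a b : ceq (TScal (a + b)) (TAdd (TScal a) (TScal b))
| ceq_scalM a b : ceq (TScal (a * b)) (TMul (TScal a) (TScal b))
| ceq_scalC a x : ceq (TMul (TScal a) x) (TMul x (TScal a))
| ceq_vecD u v : ceq (TVec (u + v)) (TAdd (TVec u) (TVec v))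
| ceq_vecZ a v : ceq (TVec (a *: v)) (TMul (TScal a) (TVec v))
| ceq_sqr v : ceq (TMul (TVec v) (TVec v)) (TScal (- S v v)).

Definition ceqb (x y : cterm) : bool := `[< ceq x y >].

Lemma ceqb_refl : reflexive ceqb.
Proof. by move=> x; apply/asboolP; apply: ceq_refl. Qed.
Lemma ceqb_sym : symmetric ceqb.
Proof. by move=> x y; apply/asboolP/asboolP; apply: ceq_sym. Qed.
Lemma ceqb_trans : transitive ceqb.
Proof. by move=> y x z /asboolP h /asboolP k; apply/asboolP; apply: ceq_trans h k. Qed.

Canonical ceqb_equiv := EquivRel ceqb ceqb_refl ceqb_sym ceqb_trans.

Definition clifford : Type := {eq_quot ceqb}.
HB.instance Definition _ := Choice.on clifford.

Definition cl_pi (x : cterm) : clifford := \pi_({eq_quot ceqb}) x.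
Definition cl_repr (x : clifford) : cterm := repr (x : {eq_quot ceqb}).

Lemma cl_piP x y : cl_pi x = cl_pi y <-> ceq x y.
Proof.
split=> [h|h]; last by apply/eqmodP/asboolP.
by apply/asboolP; move/eqmodP: h.
Qed.

Lemma cl_reprK x : cl_pi (cl_repr x) = x.
Proof. by rewrite /cl_pi /cl_repr reprK. Qed.

Lemma cl_repr_pi x : ceq (cl_repr (cl_pi x)) x.
Proof. by apply/cl_piP; rewrite cl_reprK. Qed.

Lemma cl_ind (P : clifford -> Prop) : (forall t, P (cl_pi t)) -> forall x, P x.
Proof. by move=> h x; rewrite -(cl_reprK x). Qed.

Definition cl_add (x y : clifford) := cl_pi (TAdd (cl_repr x) (cl_repr y)).
Definition cl_mul (x y : clifford) := cl_pi (TMul (cl_repr x) (cl_repr y)).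
Definition cl_opp (x : clifford) := cl_pi (TMul (TScal (-1)) (cl_repr x)).
Definition cl_scale (a : F) (x : clifford) :=
  cl_pi (TMul (TScal a) (cl_repr x)).

Lemma cl_addE x y : cl_add (cl_pi x) (cl_pi y) = cl_pi (TAdd x y).
Proof. by apply/cl_piP; apply: ceq_add; apply: cl_repr_pi. Qed.
Lemma cl_mulE x y : cl_mul (cl_pi x) (cl_pi y) = cl_pi (TMul x y).
Proof. by apply/cl_piP; apply: ceq_mul; apply: cl_repr_pi. Qed.
Lemma cl_oppE x : cl_opp (cl_pi x) = cl_pi (TMul (TScal (-1)) x).
Proof. by apply/cl_piP; apply: ceq_mul (ceq_refl _) (cl_repr_pi _). Qed.
Lemma cl_scaleE a x : cl_scale a (cl_pi x) = cl_pi (TMul (TScal a) x).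
Proof. by apply/cl_piP; apply: ceq_mul (ceq_refl _) (cl_repr_pi _). Qed.

Lemma cl_addA : associative cl_add.
Proof.
by do 3!elim/cl_ind=> ?; rewrite !cl_addE; apply/cl_piP/ceq_addA.
Qed.
Lemma cl_addC : commutative cl_add.
Proof. by do 2!elim/cl_ind=> ?; rewrite !cl_addE; apply/cl_piP/ceq_addC. Qed.
Lemma cl_add0 : left_id (cl_pi (TScal 0)) cl_add.
Proof. by elim/cl_ind=> ?; rewrite !cl_addE; apply/cl_piP/ceq_add0. Qed.
Lemma cl_addN : left_inverse (cl_pi (TScal 0)) cl_opp cl_add.
Proof. by elim/cl_ind=> ?; rewrite cl_oppE cl_addE; apply/cl_piP/ceq_addN. Qed.

HB.instance Definition _ :=
  GRing.isZmodule.Build clifford cl_addA cl_addC cl_add0 cl_addN.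

Lemma cl_mulA : associative cl_mul.
Proof. by do 3!elim/cl_ind=> ?; rewrite !cl_mulE; apply/cl_piP/ceq_mulA. Qed.
Lemma cl_mul1l : left_id (cl_pi (TScal 1)) cl_mul.
Proof. by elim/cl_ind=> ?; rewrite !cl_mulE; apply/cl_piP/ceq_mul1l. Qed.
Lemma cl_mul1r : right_id (cl_pi (TScal 1)) cl_mul.
Proof. by elim/cl_ind=> ?; rewrite !cl_mulE; apply/cl_piP/ceq_mul1r. Qed.
Lemma cl_mulDl : left_distributive cl_mul +%R.
Proof.
do 3!elim/cl_ind=> ?; rewrite /GRing.add /= !(cl_addE, cl_mulE).
exact/cl_piP/ceq_mulDl.
Qed.
Lemma cl_mulDr : right_distributive cl_mul +%R.
Proof.
do 3!elim/cl_ind=> ?; rewrite /GRing.add /= !(cl_addE, cl_mulE).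
exact/cl_piP/ceq_mulDr.
Qed.

(* Evaluation of expressions in an algebra generated by a linear image of [V]
   that satisfies the Clifford relation. *)
Section Eval.
Variables (A : algType F) (f : {linear V -> A}).
Hypothesis f_sqr : forall v, f v * f v = - (S v v)%:A.

Fixpoint ceval (x : cterm) : A :=
  match x with
  | TVec v => f v
  | TScal a => a%:A
  | TAdd x y => ceval x + ceval y
  | TMul x y => ceval x * ceval y
  end.

Lemma ceval_ceq x y : ceq x y -> ceval x = ceval y.
Proof.
elim=> {x y} //=.
- by move=> x y z _ -> _ ->.
- by move=> x x' y y' _ -> _ ->.
- by move=> x x' y y' _ -> _ ->.
- by move=> x y z; rewrite addrA.
- by move=> x y; rewrite addrC.
- by move=> x; rewrite scale0r add0r.
- by move=> x; rewrite scaleN1r mulN1r addNr scale0r.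
- by move=> x y z; rewrite mulrA.
- by move=> x; rewrite scale1r mul1r.
- by move=> x; rewrite scale1r mulr1.
- by move=> x y z; rewrite mulrDl.
- by move=> x y z; rewrite mulrDr.
- by move=> a b; rewrite scalerDl.
- by move=> a b; rewrite -scalerAl mul1r scalerA.
- by move=> a x; rewrite -scalerAl mul1r -scalerAr mulr1.
- by move=> u v; rewrite linearD.
- by move=> a v; rewrite linearZ -scalerAl mul1r.
- by move=> v; rewrite f_sqr scaleNr.
Qed.
End Eval.


(* A representation on the exterior algebra (exterior minus interior
   multiplication), built by iterated 2 x 2 matrices: it shows that the
   Clifford algebra is nontrivial and that [V] embeds in it. *)
Fixpoint ext_alg (n : nat) : algType F :=
  if n is m.+1 then M2 (ext_alg m) : algType F else F^o : algType F.

Fixpoint ext_mul (n : nat) (v : nat -> F) : ext_alg n :=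
  if n is m.+1 then mx2 (ext_mul m v) (v m)%:A 0 (- ext_mul m v) else 0.

Fixpoint int_mul (n : nat) (w : nat -> F) : ext_alg n :=
  if n is m.+1 then mx2 (int_mul m w) 0 (w m)%:A (- int_mul m w) else 0.

Lemma ext_mul_linear n a v w :
  ext_mul n (fun k => a * v k + w k) = a *: ext_mul n v + ext_mul n w.
Proof.
elim: n => [|n IHn] /=; first by rewrite scaler0 addr0.
by rewrite IHn scale_mx2 add_mx2 scalerDl scalerA scaler0 addr0 scalerN opprD.
Qed.

Lemma int_mul_linear n a v w :
  int_mul n (fun k => a * v k + w k) = a *: int_mul n v + int_mul n w.
Proof.
elim: n => [|n IHn] /=; first by rewrite scaler0 addr0.
by rewrite IHn scale_mx2 add_mx2 scalerDl scalerA scaler0 addr0 scalerN opprD.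
Qed.

Lemma ext_mul_sqr n v : ext_mul n v * ext_mul n v = 0.
Proof.
elim: n => [|n IHn] /=; first by rewrite mul0r.
rewrite mul_mx2 mulrNN IHn !(mul0r, mulr0, addr0, add0r, mulrN).
rewrite -scalerAr mulr1 -scalerAl mul1r subrr.
by apply: M2P; rewrite mx2E mxE.
Qed.

Lemma int_mul_sqr n v : int_mul n v * int_mul n v = 0.
Proof.
elim: n => [|n IHn] /=; first by rewrite mul0r.
rewrite mul_mx2 mulrNN IHn !(mul0r, mulr0, addr0, add0r, mulNr).
rewrite -scalerAr mulr1 -scalerAl mul1r subrr.
by apply: M2P; rewrite mx2E mxE.
Qed.

Lemma ext_int n v w :
  ext_mul n v * int_mul n w + int_mul n w * ext_mul n v
  = (\sum_(i < n) v i * w i)%:A.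
Proof.
elim: n => [|n IHn] /=.
  by rewrite mul0r addr0 big_ord0 scale0r.
rewrite !mul_mx2 !mulrNN add_mx2 !(mul0r, mulr0, addr0, add0r, mulNr, mulrN).
rewrite -!scalerAr -!scalerAl !mulr1 !mul1r !addNr.
rewrite big_ord_recr /= scalerDl M2_1E !scale_mx2 add_mx2 !scaler0 !addr0.
by rewrite -IHn !scalerA (mulrC (w n)) addrAC [in X in mx2 _ _ _ X]addrCA
  [in X in mx2 _ _ _ X]addrC.
Qed.

Definition cl_coord (v : V) (k : nat) : F :=
  oapp (fun i => coord (vbasis fullv) i v) 0 (insub k : option 'I_(\dim {:V})).

Definition cl_dual (v : V) (k : nat) : F := S v (vbasis {:V})`_k.

Lemma sum_coord_dual u v :
  \sum_(i < \dim {:V}) cl_coord u i * cl_dual v i = S v u.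
Proof.
rewrite {2}(coord_vbasis (memvf u)) linear_sumr; apply: eq_bigr => i _.
by rewrite linearZr_LR /= /cl_coord valK.
Qed.

Definition cl_rep (v : V) : ext_alg (\dim {:V}) :=
  ext_mul _ (cl_coord v) - int_mul _ (cl_dual v).

Lemma cl_coord_linear a u v k :
  cl_coord (a *: u + v) k = a * cl_coord u k + cl_coord v k.
Proof.
rewrite /cl_coord; case: insubP => [i _ _|_] /=; last by rewrite mulr0 addr0.
by rewrite linearP.
Qed.

Lemma cl_dual_linear a u v k :
  cl_dual (a *: u + v) k = a * cl_dual u k + cl_dual v k.
Proof. by rewrite /cl_dual linearDl linearZl_LR. Qed.

Lemma cl_rep_linear : linear cl_rep.
Proof.
move=> a u v; rewrite /cl_rep.
rewrite (_ : cl_coord _ = fun k => a * cl_coord u k + cl_coord v k);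
  last by apply/funext => k; rewrite cl_coord_linear.
rewrite (_ : cl_dual (a *: u + v) = fun k => a * cl_dual u k + cl_dual v k);
  last by apply/funext => k; rewrite cl_dual_linear.
by rewrite ext_mul_linear int_mul_linear scalerBr opprD addrACA.
Qed.
HB.instance Definition _ :=
  GRing.isLinear.Build F V (ext_alg (\dim {:V})) _ cl_rep cl_rep_linear.

Lemma cl_rep_sqr v : cl_rep v * cl_rep v = - (S v v)%:A.
Proof.
rewrite {1 2}/cl_rep mulrBl !mulrBr ext_mul_sqr int_mul_sqr.
by rewrite sub0r subr0 -opprD ext_int sum_coord_dual.
Qed.

Lemma cl_nonzero : cl_pi (TScal 1) != 0 :> clifford.
Proof.
apply/eqP => /cl_piP /(ceval_ceq cl_rep_sqr) /eqP.
by rewrite /= scale1r scale0r oner_eq0.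
Qed.

HB.instance Definition _ := GRing.Zmodule_isNzRing.Build clifford
  cl_mulA cl_mul1l cl_mul1r cl_mulDl cl_mulDr cl_nonzero.

Lemma cl_scalerA a b x : cl_scale a (cl_scale b x) = cl_scale (a * b) x.
Proof.
elim/cl_ind: x => x; rewrite !cl_scaleE; apply/cl_piP.
apply: ceq_trans (ceq_mulA _ _ _) _.
by apply: ceq_mul (ceq_sym (ceq_scalM _ _)) (ceq_refl _).
Qed.
Lemma cl_scale1r : left_id 1 cl_scale.
Proof. by elim/cl_ind=> x; rewrite cl_scaleE; apply/cl_piP/ceq_mul1l. Qed.
Lemma cl_scalerDr : right_distributive cl_scale +%R.
Proof.
move=> a; do 2!elim/cl_ind=> ?; rewrite /GRing.add /= !(cl_addE, cl_scaleE).
exact/cl_piP/ceq_mulDr.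
Qed.
Lemma cl_scalerDl x : {morph cl_scale^~ x : a b / a + b}.
Proof.
move=> a b; elim/cl_ind: x => x.
rewrite [in RHS]/GRing.add /= !cl_scaleE cl_addE; apply/cl_piP.
apply: ceq_trans (ceq_mulDl _ _ _).
by apply: ceq_mul (ceq_scalD _ _) (ceq_refl _).
Qed.
HB.instance Definition _ := GRing.Zmodule_isLmodule.Build F clifford
  cl_scalerA cl_scale1r cl_scalerDr cl_scalerDl.

Lemma cl_scalerAl (a : F) (x y : clifford) : a *: (x * y) = (a *: x) * y.
Proof.
elim/cl_ind: x => x; elim/cl_ind: y => y.
rewrite /GRing.mul /GRing.scale /= !(cl_mulE, cl_scaleE).
exact/cl_piP/ceq_mulA.
Qed.
HB.instance Definition _ :=
  GRing.Lmodule_isLalgebra.Build F clifford cl_scalerAl.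

Lemma cl_scalerAr (a : F) (x y : clifford) : a *: (x * y) = x * (a *: y).
Proof.
elim/cl_ind: x => x; elim/cl_ind: y => y.
rewrite /GRing.mul /GRing.scale /= !(cl_mulE, cl_scaleE); apply/cl_piP.
apply: ceq_trans (ceq_mulA _ _ _) _; apply: ceq_trans (ceq_sym (ceq_mulA _ _ _)).
by apply: ceq_mul (ceq_scalC _ _) (ceq_refl _).
Qed.
HB.instance Definition _ :=
  GRing.Lalgebra_isAlgebra.Build F clifford cl_scalerAr.

HB.instance Definition _ := GRing.NzRing_hasMulInverse.Build clifford
  (@cmulVr clifford) (@cmulrV clifford) (@cunitP clifford)
  (@cinv_out clifford).

Lemma cl_piD x y : cl_pi (TAdd x y) = cl_pi x + cl_pi y.
Proof. by rewrite /GRing.add /= cl_addE. Qed.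
Lemma cl_piM x y : cl_pi (TMul x y) = cl_pi x * cl_pi y.
Proof. by rewrite /GRing.mul /= cl_mulE. Qed.
Lemma cl_piS a : cl_pi (TScal a) = a%:A.
Proof.
by rewrite /GRing.scale /= cl_scaleE; apply/cl_piP/ceq_sym/ceq_mul1r.
Qed.

Definition cl_iota (v : V) : clifford := cl_pi (TVec v).

Lemma cl_iota_linear : linear cl_iota.
Proof.
move=> a u v; rewrite /cl_iota [in RHS]/GRing.scale /= cl_scaleE -cl_piD.
apply/cl_piP; apply: ceq_trans (ceq_vecD _ _) _.
exact: ceq_add (ceq_vecZ _ _) (ceq_refl _).
Qed.
HB.instance Definition _ :=
  GRing.isLinear.Build F V clifford _ cl_iota cl_iota_linear.

Lemma cl_iota_sqr v : cl_iota v * cl_iota v = - (S v v)%:A.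
Proof.
rewrite /cl_iota -cl_piM -scaleNr -cl_piS.
exact/cl_piP/ceq_sqr.
Qed.

Section Lift.
Variables (A : algType F) (f : {linear V -> A}).
Hypothesis f_sqr : forall v, f v * f v = - (S v v)%:A.

Definition cl_lift (x : clifford) : A := ceval f (cl_repr x).

Lemma cl_liftE t : cl_lift (cl_pi t) = ceval f t.
Proof. exact/(ceval_ceq f_sqr)/cl_repr_pi. Qed.

Lemma cl_lift_linear : linear cl_lift.
Proof.
move=> a; elim/cl_ind=> x; elim/cl_ind=> y.
rewrite [in LHS]/GRing.scale /= cl_scaleE -cl_piD !cl_liftE /=.
by rewrite -scalerAl mul1r.
Qed.

Lemma cl_lift_monoid : monoid_morphism cl_lift.
Proof.
split=> [|x y]; first by rewrite cl_liftE /= scale1r.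
by elim/cl_ind: x => x; elim/cl_ind: y => y; rewrite -cl_piM !cl_liftE.
Qed.

Lemma cl_lift_iota v : cl_lift (cl_iota v) = f v.
Proof. exact: cl_liftE. Qed.
End Lift.

Lemma cl_universal (A : algType F) (f : {linear V -> A}) :
  (forall v, f v * f v = - (S v v)%:A) ->
  exists! g : clifford -> A,
    [/\ linear g, monoid_morphism g & forall v, g (cl_iota v) = f v].
Proof.
move=> f_sqr; exists (cl_lift f); split.
  by split; [exact: cl_lift_linear|exact: cl_lift_monoid|exact: cl_lift_iota].
move=> g [glin [g1 gM] giota]; apply/funext; elim/cl_ind=> t.
rewrite cl_liftE //.
have gZ a x : g (a *: x) = a *: g x.
  have g0 : g 0 = 0 by rewrite -(addNr 0) -scaleN1r glin scaleN1r addNr.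
  by rewrite -[a *: x]addr0 glin g0 addr0.
have gD x y : g (x + y) = g x + g y by rewrite -{1}(scale1r x) glin scale1r.
elim: t => [v|a|x IHx y IHy|x IHx y IHy] /=.
- by rewrite giota.
- by rewrite cl_piS gZ g1.
- by rewrite cl_piD gD IHx IHy.
- by rewrite cl_piM gM IHx IHy.
Qed.

Lemma cl_iota_inj : injective cl_iota.
Proof.
move=> u v /(congr1 (cl_lift cl_rep)); rewrite !(cl_lift_iota cl_rep_sqr).
move/eqP; rewrite -subr_eq0 -linearB /= => /eqP h; apply/eqP.
rewrite -subr_eq0; move: (u - v) h => {u v} w w0.
rewrite (coord_vbasis (memvf w)) big1 // => j _.
have := ext_int (\dim {:V}) (cl_coord w) (fun k => (k == j)%:R).
have -> : ext_mul (\dim {:V}) (cl_coord w) = int_mul _ (cl_dual w).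
  by apply/eqP; rewrite -subr_eq0; apply/eqP.
have intC : forall n a b, int_mul n a * int_mul n b + int_mul n b * int_mul n a = 0.
  move=> n a b; have := int_mul_sqr n (fun k => 1 * a k + b k).
  rewrite int_mul_linear scale1r mulrDl !mulrDr !int_mul_sqr.
  by rewrite add0r addr0.
rewrite intC (bigD1 j) //= eqxx mulr1 big1 ?addr0; last first.
  by move=> i /negbTE ij; rewrite (inj_eq val_inj) ij mulr0.
move/eqP; rewrite eq_sym scaler_eq0 oner_eq0 orbF /cl_coord valK /=.
by move=> /eqP ->; rewrite scale0r.
Qed.

(* x |-> x', the algebra automorphism with v' = - v. *)
Definition cl_prime : clifford -> clifford := cl_lift (\- cl_iota).

Lemma cl_prime_sqr v :
  (\- cl_iota : V -> clifford) v * (\- cl_iota : V -> clifford) v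
  = - (S v v)%:A.
Proof. by rewrite /= mulrNN cl_iota_sqr. Qed.

HB.instance Definition _ := GRing.isLinear.Build F clifford clifford _ cl_prime
  (cl_lift_linear cl_prime_sqr).
HB.instance Definition _ := GRing.isMonoidMorphism.Build clifford clifford
  cl_prime (cl_lift_monoid cl_prime_sqr).

Lemma cl_prime_iota v : cl_prime (cl_iota v) = - cl_iota v.
Proof. exact: (cl_lift_iota cl_prime_sqr). Qed.

(* x |-> x ^*, the anti-automorphism with v ^* = v. *)
Fixpoint trev (t : cterm) : cterm :=
  match t with
  | TAdd x y => TAdd (trev x) (trev y)
  | TMul x y => TMul (trev y) (trev x)
  | _ => t
  end.

Lemma trev_ceq x y : ceq x y -> ceq (trev x) (trev y).
Proof.
move=> h; elim: h; clear; simpl; intros; try by [constructor].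
- by eapply ceq_trans; eassumption.
- apply: ceq_trans (ceq_addN (trev x)).
  by apply: ceq_add (ceq_sym (ceq_scalC _ _)) (ceq_refl _).
- exact/ceq_sym/ceq_mulA.
- by rewrite mulrC; apply: ceq_scalM.
- exact/ceq_sym/ceq_scalC.
- exact: ceq_trans (ceq_vecZ _ _) (ceq_scalC _ _).
Qed.

Definition cl_star (x : clifford) : clifford := cl_pi (trev (cl_repr x)).

Lemma cl_starE t : cl_star (cl_pi t) = cl_pi (trev t).
Proof. exact/cl_piP/trev_ceq/cl_repr_pi. Qed.

Lemma cl_star_linear : linear cl_star.
Proof.
move=> a; elim/cl_ind=> x; elim/cl_ind=> y.
rewrite [in LHS]/GRing.scale /= cl_scaleE -cl_piD !cl_starE /= cl_piD.
by rewrite cl_piM cl_piS -scalerAr mulr1.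
Qed.
HB.instance Definition _ :=
  GRing.isLinear.Build F clifford clifford _ cl_star cl_star_linear.

Lemma cl_starM x y : cl_star (x * y) = cl_star y * cl_star x.
Proof.
elim/cl_ind: x => x; elim/cl_ind: y => y.
by rewrite -cl_piM !cl_starE /= cl_piM.
Qed.

Lemma cl_star1 : cl_star 1 = 1.
Proof. exact: cl_starE. Qed.

Lemma cl_star_iota v : cl_star (cl_iota v) = cl_iota v.
Proof. exact: cl_starE. Qed.

Lemma cl_starK : involutive cl_star.
Proof.
elim/cl_ind=> t; rewrite !cl_starE; congr cl_pi.
by elim: t => //= x -> y ->.
Qed.

Definition cl_bar (x : clifford) : clifford := cl_prime (cl_star x).

Lemma cl_bar_iota v : cl_bar (cl_iota v) = - cl_iota v.
Proof. by rewrite /cl_bar cl_star_iota cl_prime_iota. Qed.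

Definition clifford_group (x : clifford) : Prop :=
  x \is a GRing.unit /\
  forall v, exists w, x * cl_iota v * (cl_prime x)^-1 = cl_iota w.

End Clifford.

Lemma cl_gen_ind (F : fieldType) (V : vectType F) (S : {symmetric V})
    (P : clifford S -> Prop) :
  (forall v, P (cl_iota S v)) -> (forall a, P a%:A) ->
  (forall x y, P x -> P y -> P (x + y)) ->
  (forall x y, P x -> P y -> P (x * y)) -> forall x, P x.
Proof.
move=> Pv Pa PD PM; elim/cl_ind; elim=> [v|a|x IHx y IHy|x IHx y IHy].
- exact: Pv.
- by rewrite cl_piS.
- by rewrite cl_piD; apply: PD.
- by rewrite cl_piM; apply: PM.
Qed.

(* The reflection r_v of a geometry with form [S]. *)
Definition reflection (F : fieldType) (U : lmodType F) (S : U -> U -> F)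
    (v w : U) : U :=
  w - (2 * (S w v / S v v)) *: v.

Inductive generated_group (T : Type) (G : (T -> T) -> Prop) :
    (T -> T) -> Prop :=
| gen_in f : G f -> generated_group G f
| gen_id : generated_group G id
| gen_comp f g : generated_group G f -> generated_group G g ->
    generated_group G (f \o g)
| gen_inv f g : generated_group G f -> cancel f g -> cancel g f ->
    generated_group G g.

Inductive generated_subring (R : pzRingType) (B : R -> Prop) : R -> Prop :=
| gen_ring_in x : B x -> generated_subring B x
| gen_ring_1 : generated_subring B 1
| gen_ring_sub x y : generated_subring B x -> generated_subring B y ->
    generated_subring B (x - y)
| gen_ring_mul x y : generated_subring B x -> generated_subring B y ->
    generated_subring B (x * y).

Section OrthogonalSum.
Variables (F : fieldType) (U V : vectType F).
Variables (SU : {symmetric U}) (SV : {symmetric V}).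

Definition osum (x y : U * V) : F := SU x.1 y.1 + SV x.2 y.2.

Lemma osum_bilinear : bilinear_for *%R ( *%R : F -> F -> F) osum.
Proof.
split=> z a x y; rewrite /osum /=.
  by rewrite !linearPl /= addrACA mulrDr.
by rewrite !linearPr /= addrACA mulrDr.
Qed.
HB.instance Definition _ :=
  bilinear_isBilinear.Build F _ _ F *%R (idfun \; *%R) osum osum_bilinear.

Lemma osum_sym x y : osum x y = (-1) ^+ false * idfun (osum y x).
Proof.
by rewrite /osum expr0 mul1r /= (hermC SU) (hermC SV) /= expr0 !mul1r.
Qed.
HB.instance Definition _ :=
  isHermitianSesquilinear.Build F (U * V)%type false idfun osum osum_sym.
End OrthogonalSum.

(* The hyperbolic plane P, with f1 = (1, 0) and f2 = (0, 1) isotropic and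
   S(f1, f2) = -1/2. *)
Definition hplane_form (x y : 'rV[rat]_2) : rat :=
  - (2^-1 * (x 0 0 * y 0 1 + x 0 1 * y 0 0)).

Lemma hplane_bilinear :
  bilinear_for *%R ( *%R : rat -> rat -> rat) hplane_form.
Proof. by split=> z a x y; rewrite /hplane_form /= !mxE; ring. Qed.
HB.instance Definition _ :=
  bilinear_isBilinear.Build rat _ _ rat *%R (idfun \; *%R) hplane_form
    hplane_bilinear.

Lemma hplane_sym x y :
  hplane_form x y = (-1) ^+ false * idfun (hplane_form y x).
Proof. by rewrite /hplane_form /=; ring. Qed.
HB.instance Definition _ :=
  isHermitianSesquilinear.Build rat 'rV[rat]_2 false idfun hplane_form hplane_sym.

Section Vahlen.
Variables (V : vectType rat) (S : {symmetric V}).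

Local Notation CV := (clifford S).
Local Notation iV := (cl_iota S).

Definition vahlen_space : vectType rat := (V * 'rV[rat]_2)%type.
Definition vahlen_form : {symmetric vahlen_space} := osum S hplane_form.

Local Notation CW := (clifford vahlen_form).
Local Notation iW := (cl_iota vahlen_form).

(* The image under phi of v + l1 f1 + l2 f2. *)
Definition phi_vec (w : vahlen_space) : M2 CV :=
  mx2 (iV w.1) (w.2 0 0)%:A (w.2 0 1)%:A (cl_bar (iV w.1)).

Lemma phi_vec_linear : linear phi_vec.
Proof.
move=> a [u x] [v y]; rewrite /phi_vec /= scale_mx2 add_mx2 !mxE.
by rewrite !cl_bar_iota !linearP /= !scalerDl !scalerA ?scalerN ?opprD.
Qed.
HB.instance Definition _ :=
  GRing.isLinear.Build rat vahlen_space (M2 CV) _ phi_vec phi_vec_linear.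

Lemma phi_vec_sqr w : phi_vec w * phi_vec w = - (vahlen_form w w)%:A.
Proof.
case: w => [v x]; rewrite /phi_vec /= mul_mx2 cl_bar_iota mulrNN.
rewrite !cl_iota_sqr !mulr_algl !mulr_algr !scalerN !subrr !scalerA.
rewrite -!scaleNr -!scalerDl M2_1E scale_mx2 !scaler0.
by rewrite /osum /=; congr mx2; congr (_ *: _); rewrite /hplane_form /=; field.
Qed.

Definition phi : CW -> M2 CV := cl_lift phi_vec.

HB.instance Definition _ := GRing.isLinear.Build rat CW (M2 CV) _ phi
  (cl_lift_linear phi_vec_sqr).
HB.instance Definition _ := GRing.isMonoidMorphism.Build CW (M2 CV) phi
  (cl_lift_monoid phi_vec_sqr).

Lemma phi_iota w : phi (iW w) = phi_vec w.
Proof. exact: (cl_lift_iota phi_vec_sqr). Qed.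

Definition vahlen (A : M2 CV) : Prop :=
  exists2 x : CW, clifford_group x & A = phi x.

Definition vahlen_alpha (A : M2 CV) : M2 CV :=
  mx2 (cl_prime (A 0 0)) (- cl_prime (A 0 1))
      (- cl_prime (A 1 0)) (cl_prime (A 1 1)).

Definition vahlen_gamma (A : M2 CV) : M2 CV :=
  mx2 (cl_star (A 1 1)) (- cl_star (A 0 1))
      (- cl_star (A 1 0)) (cl_star (A 0 0)).

(* On the Vahlen group this is a rational scalar matrix. *)
Definition vahlen_norm (A : M2 CV) : M2 CV := A * vahlen_gamma A.

Definition vahlen_plus (A : M2 CV) : Prop := vahlen A /\ vahlen_norm A = 1.

Definition h2_set : {pred M2 CV} :=
  fun X => `[< exists w : vahlen_space, X = phi (iW w) >].

Lemma h2_submod_closed : submod_closed h2_set.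
Proof.
split=> [|a X Y /asboolP[u ->] /asboolP[v ->]]; apply/asboolP.
  by exists 0; rewrite !linear0.
by exists (a *: u + v); rewrite !linearP.
Qed.
HB.instance Definition _ := GRing.isSubmodClosed.Build rat (M2 CV) h2_set
  h2_submod_closed.

Record h2 := MkH2 { h2_val : M2 CV; _ : h2_val \in h2_set }.
HB.instance Definition _ := [isSub for h2_val].
HB.instance Definition _ := [Choice of h2 by <:].
HB.instance Definition _ := [SubChoice_isSubLmodule of h2 by <:].

Lemma h2_quad_ex (X : h2) :
  exists r : rat, r%:A =
    h2_val X 0 0 * cl_bar (h2_val X 0 0) - h2_val X 0 1 * h2_val X 1 0.
Proof.
case: X => X /= /asboolP[[v x] ->]; rewrite phi_iota /phi_vec /= !mx2E.
exists (S v v - x 0 0 * x 0 1).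
rewrite cl_bar_iota mulrN cl_iota_sqr opprK -scalerAl mul1r scalerA.
by rewrite scalerBl.
Qed.

(* Q(X) = v \bar v - l1 l2, and its symmetric bilinear form. *)
Definition h2_quad (X : h2) : rat := projT1 (cid (h2_quad_ex X)).

Lemma h2_quadE (X : h2) :
  (h2_quad X)%:A =
  h2_val X 0 0 * cl_bar (h2_val X 0 0) - h2_val X 0 1 * h2_val X 1 0.
Proof. by rewrite /h2_quad; case: cid. Qed.

Definition h2_form (X Y : h2) : rat :=
  (h2_quad (X + Y) - h2_quad X - h2_quad Y) / 2.

Lemma vahlen_alphaD A B :
  vahlen_alpha (A + B) = vahlen_alpha A + vahlen_alpha B.
Proof.
by rewrite /vahlen_alpha add_mx2 !M2_addE !linearD.
Qed.

Lemma vahlen_alphaM A B :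
  vahlen_alpha (A * B) = vahlen_alpha A * vahlen_alpha B.
Proof.
rewrite /vahlen_alpha mul_mx2 !M2_mulE !rmorphD !rmorphM /=.
by rewrite !mulNr !mulrN !opprK !opprD.
Qed.

Lemma vahlen_alpha_phi x : vahlen_alpha (phi x) = phi (cl_prime x).
Proof.
elim/cl_gen_ind: x => [w|a|x y IHx IHy|x y IHx IHy].
- rewrite cl_prime_iota rmorphN /= phi_iota /vahlen_alpha /phi_vec !mx2E.
  rewrite cl_bar_iota rmorphN /= cl_prime_iota !linearZ /= !rmorph1.
  by rewrite -[RHS]scaleN1r scale_mx2 !scaleN1r !scalerN.
- rewrite !linearZ /= !rmorph1 M2_1E scale_mx2 /vahlen_alpha !mx2E scaler0.
  by rewrite rmorph0 oppr0 linearZ /= rmorph1.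
- by rewrite !rmorphD vahlen_alphaD IHx IHy.
- by rewrite !rmorphM vahlen_alphaM IHx IHy.
Qed.

(* eta(A)(X) = A X alpha(A)^-1, which lies in H_2 for A in the Vahlen group;
   elsewhere [eta] takes junk values. *)
Definition eta (A : M2 CV) (X : h2) : h2 :=
  insubd X (A * h2_val X * (vahlen_alpha A)^-1).

Lemma etaE (A : M2 CV) (X : h2) : vahlen A ->
  h2_val (eta A X) = A * h2_val X * (vahlen_alpha A)^-1.
Proof.
move=> [x [xu xV] Ax]; rewrite /eta; apply: insubdK.
case: X => X /= /asboolP[w ->]; have [w' xww'] := xV w.
apply/asboolP; exists w'; rewrite -xww' Ax vahlen_alpha_phi !rmorphM /=.
by rewrite rmorphV // rmorph_unit.
Qed.

End Vahlen.

(* Finite types A_n, D_n, E_n; node k of the Dynkin diagram is numbered k.+1 in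
   Bourbaki's labelling. *)
Inductive ade := TypeA | TypeD | TypeE.

Definition dynkin_edge (t : ade) (n i j : nat) : bool :=
  match t with
  | TypeA => j == i.+1
  | TypeD => (j == i.+1) && (j < n.-1)%N || (i == n - 3)%N && (j == n.-1)
  | TypeE => (i, j) \in [:: (0, 2); (1, 3); (2, 3); (3, 4); (4, 5); (5, 6);
                           (6, 7)]%N
  end.

Definition cartan (t : ade) (n : nat) : 'M[rat]_n :=
  \matrix_(i < n, j < n)
    if i == j then 2
    else if dynkin_edge t n i j || dynkin_edge t n j i then -1 else 0.

Definition listed_type (t : ade) (n : nat) : bool :=
  match t with
  | TypeA => (1 <= n <= 6)%N
  | TypeD => (5 <= n <= 8)%N
  | TypeE => (6 <= n <= 8)%N
  end.

Section LieData.
Variables (t : ade) (n : nat).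

Local Notation V := 'rV[rat]_n.

Definition simple_root (i : 'I_n) : V := delta_mx 0 i.

Definition kappa (u v : V) : rat := (u *m cartan t n *m v^T) 0 0.

Inductive finite_simple_reflection : (V -> V) -> Prop :=
| FiniteSimple i : finite_simple_reflection (reflection kappa (simple_root i)).

Definition root (b : V) : Prop :=
  exists w i, generated_group finite_simple_reflection w /\
              b = w (simple_root i).

Definition highest_root (theta : V) : Prop :=
  root theta /\ forall b, root b -> forall i, b 0 i <= theta 0 i.

(* The form of V^(1/2). *)
Definition half_form (u v : V) : rat := 2^-1 * kappa u v.

Lemma half_bilinear : bilinear_for *%R ( *%R : rat -> rat -> rat) half_form.
Proof.
split=> z a x y; rewrite /half_form /kappa /=.
  by rewrite !mulmxDl -!scalemxAl !mxE; ring.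
by rewrite linearP /= mulmxDr -scalemxAr !mxE; ring.
Qed.
HB.instance Definition _ :=
  bilinear_isBilinear.Build rat _ _ rat *%R (idfun \; *%R) half_form
    half_bilinear.

Lemma cartan_tr : (cartan t n)^T = cartan t n.
Proof. by apply/matrixP => i j; rewrite !mxE eq_sym orbC. Qed.

Lemma half_sym u v : half_form u v = (-1) ^+ false * idfun (half_form v u).
Proof.
rewrite /half_form /= mul1r; congr (_ * _); rewrite /kappa.
have -> : (u *m cartan t n *m v^T) 0 0 = (u *m cartan t n *m v^T)^T 0 0.
  by rewrite [RHS]mxE.
by rewrite !trmx_mul trmxK cartan_tr mulmxA.
Qed.
HB.instance Definition _ :=
  isHermitianSesquilinear.Build rat V false idfun half_form half_sym.

Local Notation Vhalf := (half_form : {symmetric V}).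
Local Notation CV := (clifford Vhalf).
Local Notation iV := (cl_iota Vhalf).

Inductive order_gen : CV -> Prop := OrderGen i : order_gen (iV (simple_root i)).

Definition order : CV -> Prop := generated_subring order_gen.

Definition order_M2 (A : M2 CV) : Prop := forall i j, order (A i j).

Definition order_GL2 (A : M2 CV) : Prop :=
  order_M2 A /\ exists B, [/\ order_M2 B, A * B = 1 & B * A = 1].

Definition vahlen_plus_order (A : M2 CV) : Prop :=
  vahlen_plus A /\ order_GL2 A.

(* The simple roots X_{-1}, X_0, X_1, ..., X_n of the canonical Lorentzian
   extension. *)
Variable theta : V.

Inductive lorentz_root : M2 CV -> Prop :=
| LorentzM1 : lorentz_root (mx2 0 1 (-1) 0)
| Lorentz0 : lorentz_root (mx2 (- iV theta) (-1) 0 (- cl_bar (iV theta)))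
| LorentzS i : lorentz_root
    (mx2 (iV (simple_root i)) 0 0 (cl_bar (iV (simple_root i)))).

Lemma lorentz_root_h2 X : lorentz_root X -> X \in @h2_set _ Vhalf.
Proof.
case=> [||i]; apply/asboolP.
- exists (0, \row_j if j == 0 then 1 else -1); rewrite phi_iota /phi_vec /= !mxE cl_bar_iota linear0 oppr0.
  by rewrite scaleN1r scale1r.
- exists (- theta, - delta_mx 0 0); rewrite phi_iota /phi_vec /= !mxE !cl_bar_iota.
  by rewrite (linearN iV) eqxx /= mulr1n mulr0n oppr0 scaleN1r scale0r.
- exists (simple_root i, 0); rewrite phi_iota /phi_vec /= !mxE.
  by rewrite scale0r.
Qed.

Inductive lorentz_reflection : (h2 Vhalf -> h2 Vhalf) -> Prop :=
| LorentzReflection X : lorentz_root (h2_val X) ->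
    lorentz_reflection (reflection (@h2_form _ Vhalf) X).

Definition lorentz_weyl_group : (h2 Vhalf -> h2 Vhalf) -> Prop :=
  generated_group lorentz_reflection.

End LieData.

(* Main.v *)
(* An element [A] of V^+(O) acts by [eta] on the root lattice of C^++, and it acts
   trivially on the discriminant group: for [y] in the dual lattice,
   [A y alpha(A)^-1 - y] is [(A y - y alpha(A)) alpha(A)^-1], and
   [x |-> x v - v x'] is a twisted derivation that sends the generators of O to
   integers.  Conversely every isometry [g] of that kind is in the Weyl group, up
   to the sign of the hyperbolic plane.  Up to this sign, [g f1] lies in the
   forward light cone, and simple reflections take it to a dominant isotropic
   vector, which must be [f1]; Eichler transvections, which are products of two
   reflections in affine roots, then also fix [f2]; what remains is an isometry of
   the finite root lattice, which after finite reflections fixes the Weyl vector,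
   hence permutes the simple roots, and no nontrivial diagram automorphism of the
   listed types is trivial on the discriminant group.  The sign and the kernel are
   determined by one fact: an element [a] of the Clifford algebra with [a v = v a']
   for all [v] is a scalar, and the norm condition reads [a^2 = 1] or [a^2 = -1]. *)

From HB Require Import structures.
Require Import Defs.
From mathcomp Require Import all_boot all_order all_algebra.
From mathcomp Require Import ring lra boolp.

Set Implicit Arguments.
Unset Strict Implicit.
Unset Printing Implicit Defensive.

Import Order.TTheory GRing.Theory Num.Theory.

Local Open Scope ring_scope.

(** * Clifford algebras *)

(** That the Weyl group lies in the image is immediate, because the root matrices themselves belong
    to V^+(O). The weight is on the other inclusion: the isometry group of the root lattice also
    contains the diagram automorphisms of the finite part and the sign change on the hyperbolic
    plane, and V^+(O) has to exclude both. Integrality of the entries excludes the first, the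
    condition N = 1 the second. O is given by generators only, and no basis of monomials is
    constructed. Integrality is extracted by derivations along the fundamental weights, which strip
    one generator at a time. Root systems are bypassed as well: roots of the finite lattice enter as
    integral vectors of norm 2, and positive definiteness comes from the Weyl vector. What depends
    on the type is reduced to the inverse Cartan matrix, the coefficients of the highest root and
    the diagram automorphisms, all certified by computation. *)

Lemma ord2 (i : 'I_2) : i = 0 \/ i = 1.
Proof. by case: i => [[|[|//]] p]; [left|right]; apply: val_inj. Qed.

Section CliffordMap.
Variables (F : fieldType) (V : vectType F) (S : {symmetric V}).
Variables (A : algType F) (f : {linear V -> A}).
Hypothesis f_sqr : forall v, f v * f v = - (S v v)%:A.

Lemma clifford_map_anticomm v w : f v * f w + f w * f v = - (2 * S v w)%:A.
Proof.
have := f_sqr (v + w); rewrite linearD /= mulrDl !mulrDr !f_sqr.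
rewrite linearDl /= !linearDr /= (hermC S w v) /= expr0 mul1r.
rewrite -!addrA => e; apply: (addrI (- (S v v)%:A)); apply: (addIr (- (S w w)%:A)).
by rewrite -!addrA e -!scaleNr -!scalerDl; congr (_ *: _); ring.
Qed.

(** Since [f r] squares to -1, its image [- f r] under the sign automorphism has inverse [f r], so
    the left side is the twisted conjugation by [r]. The map [f] is arbitrary in order to serve both
    [cl_iota] and [phi_vec]. *)
Lemma clifford_map_reflection r w : S r r = 1 ->
  f r * f w * f r = f (w - (2 * S w r) *: r).
Proof.
move=> r1; have := clifford_map_anticomm r w.
move/(congr1 (fun x => x - f w * f r)); rewrite addrK => ->.
rewrite mulrBl -mulrA f_sqr r1 scale1r mulrN mulr1 opprK mulNr mulr_algl.
by rewrite [RHS]linearB [f (_ *: _)]linearZ addrC (hermC S r w) /= expr0 mul1r.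
Qed.

End CliffordMap.

Section Clifford.
Variables (F : fieldType) (V : vectType F) (S : {symmetric V}).
Local Notation C := (clifford S).
Local Notation i := (cl_iota S).

Lemma cl_iota_anticomm v w : i v * i w + i w * i v = - (2 * S v w)%:A.
Proof. exact: (clifford_map_anticomm (cl_iota_sqr S)). Qed.

Lemma cl_alg_inj (a b : F) : a%:A = b%:A :> C -> a = b.
Proof. exact: (fmorph_inj (in_alg C)). Qed.

Lemma cl_primeK : involutive (@cl_prime F V S).
Proof.
elim/cl_gen_ind=> [v|a|x y IHx IHy|x y IHx IHy].
- by rewrite cl_prime_iota rmorphN /= cl_prime_iota opprK.
- by rewrite !linearZ /= !rmorph1.
- by rewrite !rmorphD /= IHx IHy.
- by rewrite !rmorphM /= IHx IHy.
Qed.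

(** Up to the factor -2, the contraction of [x] with the linear form [S v]. *)
Definition cl_der (v : V) (x : C) : C := x * i v - i v * cl_prime x.

Lemma cl_derD v x y : cl_der v (x + y) = cl_der v x + cl_der v y.
Proof. by rewrite /cl_der rmorphD /= mulrDl mulrDr opprD addrACA. Qed.

Lemma cl_derZ v a x : cl_der v (a *: x) = a *: cl_der v x.
Proof. by rewrite /cl_der linearZ /= -scalerAl -scalerAr scalerBr. Qed.

Lemma cl_derB v x y : cl_der v (x - y) = cl_der v x - cl_der v y.
Proof. by rewrite cl_derD -scaleN1r cl_derZ scaleN1r. Qed.

Lemma cl_der1 v : cl_der v 1 = 0.
Proof. by rewrite /cl_der rmorph1 mul1r mulr1 subrr. Qed.

Lemma cl_derM v x y :
  cl_der v (x * y) = x * cl_der v y + cl_der v x * cl_prime y.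
Proof.
rewrite /cl_der rmorphM /= mulrBr mulrBl !mulrA.
by rewrite [RHS]addrA subrK.
Qed.

Lemma cl_der_iota v w : cl_der v (i w) = - (2 * S v w)%:A.
Proof. by rewrite /cl_der cl_prime_iota mulrN opprK addrC cl_iota_anticomm. Qed.

End Clifford.

(** * The operations alpha and gamma on 2 x 2 matrices *)

Section VahlenGroup.
Variables (V : vectType rat) (S : {symmetric V}).
Local Notation C := (clifford S).
Local Notation M := (M2 C).
Implicit Types A B : M.

Lemma vahlen_alphaK : involutive (@vahlen_alpha V S).
Proof.
by move=> A; apply: M2P; rewrite !mx2E ?rmorphN /= ?cl_primeK ?opprK.
Qed.

Lemma vahlen_alpha1 : vahlen_alpha (1 : M) = 1.
Proof. by rewrite M2_1E /vahlen_alpha !mx2E rmorph1 rmorph0 oppr0. Qed.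

Lemma vahlen_alphaN A : vahlen_alpha (- A) = - vahlen_alpha A.
Proof. by apply: M2P; rewrite M2_oppE !mx2E M2_oppE rmorphN. Qed.

Lemma vahlen_gammaN A : vahlen_gamma (- A) = - vahlen_gamma A.
Proof. by apply: M2P; rewrite M2_oppE !mx2E M2_oppE linearN. Qed.

Lemma vahlen_gammaK : involutive (@vahlen_gamma V S).
Proof.
by move=> A; apply: M2P; rewrite !mx2E ?linearN /= ?cl_starK ?opprK.
Qed.

Lemma vahlen_gammaM A B :
  vahlen_gamma (A * B) = vahlen_gamma B * vahlen_gamma A.
Proof.
rewrite /vahlen_gamma mul_mx2; apply: M2P; rewrite !mx2E M2_mulE raddfD /= !cl_starM.
- by rewrite mulrNN addrC.
- by rewrite mulrN mulNr -opprD addrC.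
- by rewrite mulrN mulNr -opprD addrC.
- by rewrite mulrNN addrC.
Qed.

Lemma vahlen_gamma1 : vahlen_gamma (1 : M) = 1.
Proof. by rewrite M2_1E /vahlen_gamma !mx2E cl_star1 linear0 oppr0. Qed.

End VahlenGroup.

(** * The order generated by the simple roots *)

Section GeneratedSubring.
Variables (R : pzRingType) (B : R -> Prop).
Local Notation gs := (generated_subring B).

Lemma gen_ring_0 : gs 0.
Proof. by rewrite -(subrr 1); apply: gen_ring_sub; apply: gen_ring_1. Qed.

Lemma gen_ring_mono (B' : R -> Prop) :
  (forall x, B' x -> gs x) -> forall x, generated_subring B' x -> gs x.
Proof.
move=> BB' x; elim=> {x} [x /BB'//||x y _ hx _ hy|x y _ hx _ hy].
- exact: gen_ring_1.
- exact: gen_ring_sub.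
- exact: gen_ring_mul.
Qed.

Lemma gen_ring_opp x : gs x -> gs (- x).
Proof. by move=> gx; rewrite -sub0r; apply: gen_ring_sub gx; apply: gen_ring_0. Qed.

Lemma gen_ring_add x y : gs x -> gs y -> gs (x + y).
Proof. by move=> gx gy; rewrite -[y]opprK; apply: gen_ring_sub gx (gen_ring_opp gy). Qed.

Lemma gen_ring_natmul x k : gs x -> gs (x *+ k).
Proof.
move=> gx; elim: k => [|k IHk]; first by rewrite mulr0n; apply: gen_ring_0.
by rewrite mulrS; apply: gen_ring_add.
Qed.

Lemma gen_ring_sum (I : Type) (r : seq I) (P : pred I) (f : I -> R) :
  (forall i, P i -> gs (f i)) -> gs (\sum_(i <- r | P i) f i).
Proof. by move=> gf; elim/big_ind: _ => //; [exact: gen_ring_0|exact: gen_ring_add]. Qed.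

End GeneratedSubring.

Lemma gen_ring_int (F : archiFieldType) (A : algType F) (B : A -> Prop) (a : F) x :
  a \is a Num.int -> generated_subring B x -> generated_subring B (a *: x).
Proof.
move=> /intrP[[k|k] ->] gx.
  by rewrite -pmulrn scaler_nat; apply: gen_ring_natmul.
by rewrite NegzE mulrNz scaleNr -pmulrn scaler_nat; apply/gen_ring_opp/gen_ring_natmul.
Qed.

Lemma gen_ring_alg (F : archiFieldType) (A : algType F) (B : A -> Prop) (a : F) :
  a \is a Num.int -> generated_subring B a%:A.
Proof. by move=> ai; apply: gen_ring_int ai (gen_ring_1 _). Qed.

Lemma denq_mul_int (a : rat) : `|denq a|%N%:R * a \is a Num.int.
Proof.
rewrite natr_absz gtr0_norm ?denq_gt0 // -{2}(divq_num_den a).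
by rewrite mulrC divfK ?intr_int // intr_eq0 denq_neq0.
Qed.

Section RootOrder.
Variables (t : ade) (n : nat).
Local Notation V := 'rV[rat]_n.
Local Notation CV := (clifford (@half_form t n : {symmetric V})).
Local Notation iV := (cl_iota (@half_form t n : {symmetric V})).
Local Notation order := (@Defs.order t n).
Local Notation alpha := (@simple_root n).
Local Notation C := (cartan t n).
Local Notation kappa := (@Defs.kappa t n).

Definition intv (v : V) : Prop := forall i, v 0 i \is a Num.int.
(** Entry [i] of [v *m C] is the pairing with the simple root [i], so this is the weight lattice,
    dual to the root lattice [intv]. *)
Definition dualv (v : V) : Prop := intv (v *m C).

(** The 1/2 in the form of V^(1/2) cancels the 2 of polarization: anticommutators of vectors are
    values of [kappa], hence integers on the root lattice. *)
Lemma kappa_half u v : 2 * half_form t u v = kappa u v.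
Proof. by rewrite /half_form mulrA divff // mul1r. Qed.

Lemma kappaDl u v w : kappa (u + v) w = kappa u w + kappa v w.
Proof. by rewrite /Defs.kappa !mulmxDl mxE. Qed.

Lemma kappaZl a v w : kappa (a *: v) w = a * kappa v w.
Proof. by rewrite /Defs.kappa -!scalemxAl mxE. Qed.

Lemma kappaC v w : kappa v w = kappa w v.
Proof.
by rewrite -!kappa_half; congr (2 * _); move: (half_sym t v w) => /= ->; rewrite mul1r.
Qed.

Lemma kappaBl u v w : kappa (u - v) w = kappa u w - kappa v w.
Proof. by rewrite kappaDl -scaleN1r kappaZl mulN1r. Qed.

Lemma kappaDr u v w : kappa w (u + v) = kappa w u + kappa w v.
Proof. by rewrite !(kappaC w) kappaDl. Qed.

Lemma kappaZr a v w : kappa w (a *: v) = a * kappa w v.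
Proof. by rewrite !(kappaC w) kappaZl. Qed.

Lemma kappaBr u v w : kappa w (u - v) = kappa w u - kappa w v.
Proof. by rewrite !(kappaC w) kappaBl. Qed.

Lemma kappa_suml (I : Type) (r : seq I) (P : pred I) (f : I -> V) w :
  kappa (\sum_(i <- r | P i) f i) w = \sum_(i <- r | P i) kappa (f i) w.
Proof.
elim/big_rec2: _ => [|i y x _ <-]; last by rewrite kappaDl.
by rewrite -(scale0r 0) kappaZl mul0r.
Qed.

Lemma kappa_simple u i : kappa u (alpha i) = (u *m C) 0 i.
Proof.
rewrite /Defs.kappa mxE (bigD1 i) //= [_^T _ _]mxE [alpha i _ _]mxE !eqxx mulr1.
by rewrite big1 ?addr0 // => j ji; rewrite [_^T _ _]mxE [alpha i _ _]mxE (negbTE ji) andbF mulr0.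
Qed.

Lemma dualvP v : dualv v <-> forall i, kappa v (alpha i) \is a Num.int.
Proof. by split=> h i; move: (h i); rewrite kappa_simple. Qed.

Lemma cartan_int i j : C i j \is a Num.int.
Proof. by rewrite mxE; case: ifP => _; [exact: (intr_int _ 2)|case: ifP => _]; rewrite ?rpredN ?rpred1 ?rpred0. Qed.

Lemma intv_dual v : intv v -> dualv v.
Proof.
by move=> vi i; rewrite mxE rpred_sum // => j _; rewrite rpredM // cartan_int.
Qed.

Lemma simple_root_int i : intv (alpha i).
Proof. by move=> j; rewrite mxE; case: (_ && _); rewrite ?rpred1 ?rpred0. Qed.

Lemma row_sum_simple (v : V) : v = \sum_i v 0 i *: alpha i.
Proof. exact: row_sum_delta. Qed.

(** The first [k] generators span a filtration of O by subrings. Descending it one generator at a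
    time takes the place of a basis of monomials. *)
Definition sub_gen k (x : CV) := exists2 i : 'I_n, (i < k)%N & x = iV (alpha i).
Local Notation sub_order k := (generated_subring (sub_gen k)).

Lemma sub_orderE x : sub_order n x <-> order x.
Proof.
split; apply: gen_ring_mono => {}x; first by case=> i _ ->; apply/gen_ring_in/OrderGen.
by case=> i; apply: gen_ring_in; exists i.
Qed.

Lemma sub_order_prime k x : sub_order k x -> sub_order k (cl_prime x).
Proof.
elim=> {x}.
- move=> x [i ik ->]; rewrite cl_prime_iota; apply: gen_ring_opp.
  by apply: gen_ring_in; exists i.
- by rewrite rmorph1; apply: gen_ring_1.
- by move=> x y _ hx _ hy; rewrite rmorphB; apply: gen_ring_sub.
- by move=> x y _ hx _ hy; rewrite rmorphM; apply: gen_ring_mul.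
Qed.

Lemma sub_order_star k x : sub_order k x -> sub_order k (cl_star x).
Proof.
elim=> {x}.
- move=> x [i ik ->]; rewrite cl_star_iota.
  by apply: gen_ring_in; exists i.
- by rewrite cl_star1; apply: gen_ring_1.
- by move=> x y _ hx _ hy; rewrite linearB; apply: gen_ring_sub.
- by move=> x y _ hx _ hy; rewrite cl_starM; apply: gen_ring_mul.
Qed.

(** By the Leibniz rule only generators matter, and there the derivative is [- kappa v (alpha i)],
    an integer by definition of the dual lattice. *)
Lemma sub_order_der k v x : dualv v -> sub_order k x -> sub_order k (cl_der v x).
Proof.
move=> /dualvP vd; elim=> {x}.
- move=> x [i ik ->]; rewrite cl_der_iota kappa_half; apply: gen_ring_opp.
  exact: gen_ring_alg.
- by rewrite cl_der1; apply: gen_ring_0.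
- by move=> x y _ hx _ hy; rewrite cl_derB; apply: gen_ring_sub.
- move=> x y gx hx gy hy; rewrite cl_derM; apply: gen_ring_add; apply: gen_ring_mul => //.
  exact: sub_order_prime.
Qed.

Lemma order_prime x : order x -> order (cl_prime x).
Proof. by move/sub_orderE/sub_order_prime/sub_orderE. Qed.
Lemma order_star x : order x -> order (cl_star x).
Proof. by move/sub_orderE/sub_order_star/sub_orderE. Qed.
Lemma order_der v x : dualv v -> order x -> order (cl_der v x).
Proof. by move=> vd /sub_orderE/(sub_order_der vd)/sub_orderE. Qed.

Lemma order_iota v : intv v -> order (iV v).
Proof.
move=> vi; rewrite (row_sum_simple v) linear_sum; apply: gen_ring_sum => i _.
by rewrite linearZ; apply: gen_ring_int => //; apply/gen_ring_in/OrderGen.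
Qed.

Lemma cartan_diag i : C i i = 2.
Proof. by rewrite mxE eqxx. Qed.

Lemma kappa_simple2 i j : kappa (alpha i) (alpha j) = C i j.
Proof. by rewrite kappa_simple -rowE mxE. Qed.

Lemma simple_root_sqr i : iV (alpha i) * iV (alpha i) = -1.
Proof.
have e : half_form t (alpha i) (alpha i) = 1.
  by rewrite /half_form kappa_simple2 cartan_diag mulVf.
by rewrite cl_iota_sqr /= e scale1r.
Qed.

(* A generator is moved to the right of a product with [e x = x' e - D_e(x')]. *)
Lemma sub_order_split (i : 'I_n) x : sub_order i.+1 x ->
  exists y z, [/\ sub_order i y, sub_order i z & x = y + z * iV (alpha i)].
Proof.
set e := iV (alpha i).
have eM z : e * z = cl_prime z * e - cl_der (alpha i) (cl_prime z).
  by rewrite /cl_der cl_primeK opprB addrC subrK.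
have ad : dualv (alpha i) by apply/intv_dual/simple_root_int.
elim=> {x}.
- move=> _ [j ji ->]; move: ji; rewrite ltnS leq_eqVlt => /orP[/eqP/val_inj ->|ji].
    by exists 0, 1; split; [exact: gen_ring_0|exact: gen_ring_1|rewrite add0r mul1r].
  exists (iV (alpha j)), 0; rewrite mul0r addr0; split=> //; last exact: gen_ring_0.
  by apply: gen_ring_in; exists j.
- exists 1, 0; rewrite mul0r addr0; split=> //; [exact: gen_ring_1|exact: gen_ring_0].
- move=> _ _ _ [y [z [yo zo ->]]] _ [y' [z' [yo' zo' ->]]].
  exists (y - y'), (z - z'); split; try exact: gen_ring_sub.
  by rewrite mulrBl opprD addrACA.
- move=> _ _ _ [y [z [yo zo ->]]] _ [y' [z' [yo' zo' ->]]].
  exists (y * y' - z * cl_der (alpha i) (cl_prime y') - z * cl_prime z'),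
    (y * z' + z * cl_prime y' - z * cl_der (alpha i) (cl_prime z')).
  have po := sub_order_prime; have d_o := sub_order_der ad.
  split.
  + apply: gen_ring_sub; [apply: gen_ring_sub|]; apply: gen_ring_mul => //.
      by apply/d_o/po.
    exact: po.
  + apply: gen_ring_sub; [apply: gen_ring_add|]; apply: gen_ring_mul => //.
      exact: po.
    by apply/d_o/po.
  + have -> : (y + z * e) * (y' + z' * e)
        = y * y' + y * z' * e + (z * (e * y') + z * (e * z') * e).
      by rewrite mulrDl !mulrDr !mulrA.
    rewrite !eM !mulrBr !mulrBl mulrDl !mulrA -(mulrA _ e e) simple_root_sqr mulrN1.
    by rewrite [LHS](AC (2*(2*2)) ((1*4*5)*(2*3*6))).
Qed.

Variable G : 'M[rat]_n.
Hypothesis GC : G *m C = 1%:M.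

Definition weight i : V := row i G.

Lemma weight_cartan i : weight i *m C = alpha i.
Proof. by rewrite /weight -row_mul GC row1. Qed.

Lemma kappa_weight i (v : V) : kappa (weight i) v = v 0 i.
Proof. by rewrite /Defs.kappa weight_cartan -rowE !mxE. Qed.

Lemma weight_dual i : dualv (weight i).
Proof. by rewrite /dualv weight_cartan; apply: simple_root_int. Qed.

Lemma cl_der_weight i v : cl_der (weight i) (iV v) = - (v 0 i)%:A.
Proof. by rewrite cl_der_iota kappa_half kappa_weight. Qed.

Lemma cl_der_weight_sub (i : 'I_n) k x : (k <= i)%N -> sub_order k x ->
  cl_der (weight i) x = 0.
Proof.
move=> ki; elim=> {x}.
- move=> _ [j jk ->]; rewrite cl_der_weight mxE eqxx /=.
  by rewrite (_ : i == j = false) ?scale0r ?oppr0 //; apply/gtn_eqF/(leq_trans jk).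
- exact: cl_der1.
- by move=> x y _ hx _ hy; rewrite cl_derB hx hy subr0.
- by move=> x y _ hx _ hy; rewrite cl_derM hx hy mulr0 mul0r addr0.
Qed.

(** In [x = y + z e], with [e] the generator [i], the derivation along weight [i] kills [y] and [z]
    and sends [e] to -1. It therefore returns [- z], and its vanishing removes the generator. *)
Lemma sub_order_descend (i : 'I_n) x : sub_order i.+1 x ->
  cl_der (weight i) x = 0 -> sub_order i x.
Proof.
move=> /sub_order_split[y [z [yo zo ->]]].
rewrite cl_derD cl_derM (cl_der_weight_sub (leqnn i) yo) (cl_der_weight_sub (leqnn i) zo).
rewrite cl_der_weight mxE !eqxx mul0r addr0 add0r mulrN scale1r mulr1.
by move/eqP; rewrite oppr_eq0 => /eqP ->; rewrite mul0r addr0.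
Qed.

Lemma order_der_eq0 x : order x -> (forall i, cl_der (weight i) x = 0) ->
  exists2 a : rat, a \is a Num.int & x = a%:A.
Proof.
move=> xo dx0; have: sub_order 0 x.
  have {xo}: sub_order n x by apply/sub_orderE.
  suff H k : (k <= n)%N -> sub_order k x -> sub_order 0 x by apply: H.
  elim: k => // k IHk kn xk.
  exact: (IHk (ltnW kn) (@sub_order_descend (Ordinal kn) x xk (dx0 _))).
elim=> {x xo dx0} [x [] //||x y _ [a ai ->] _ [b bi ->]|x y _ [a ai ->] _ [b bi ->]].
- by exists 1; rewrite ?rpred1 // scale1r.
- by exists (a - b); rewrite ?rpredB // scalerBl.
- by exists (a * b); rewrite ?rpredM // -scalerAl mul1r scalerA.
Qed.

Lemma order_scalar (a : rat) : order a%:A -> a \is a Num.int.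
Proof.
move/order_der_eq0; case=> [i|b bi /cl_alg_inj ->//].
by rewrite cl_derZ cl_der1 scaler0.
Qed.

(** Each coordinate is, up to sign, the derivative along a weight, thus a scalar lying in O, thus an
    integer. *)
Lemma order_iotaP v : order (iV v) <-> intv v.
Proof.
split=> [vo i|]; last exact: order_iota.
apply: order_scalar; rewrite -[_%:A]opprK -cl_der_weight.
exact: gen_ring_opp (order_der (weight_dual i) vo).
Qed.

(** Carries the computation of the constants of the derivations from O to the whole rational
    algebra. *)
Lemma clear_denominators x : exists2 k : nat, k != 0 & order (k%:R *: x).
Proof.
elim/cl_gen_ind: x => [v|a|x y [k k0 xo] [l l0 yo]|x y [k k0 xo] [l l0 yo]].
- pose d := (\prod_i `|denq (v 0%R i)|)%N; exists d.
    by rewrite -lt0n prodn_gt0 // => i; rewrite absz_gt0 denq_neq0.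
  rewrite -linearZ; apply: order_iota => i; rewrite mxE /d (bigD1 i) //=.
  by rewrite natrM mulrAC rpredM ?natr_int // denq_mul_int.
- exists `|denq a|%N; first by rewrite absz_eq0 denq_neq0.
  by rewrite scalerA; apply: gen_ring_alg; apply: denq_mul_int.
- exists (k * l)%N; first by rewrite muln_eq0 negb_or k0.
  rewrite (_ : _ *: _ = l%:R *: (k%:R *: x) + k%:R *: (l%:R *: y)); last first.
    by rewrite scalerDr !scalerA natrM [X in X *: x]mulrC.
  by apply: gen_ring_add; apply: gen_ring_int => //; apply: natr_int.
- exists (k * l)%N; first by rewrite muln_eq0 negb_or k0.
  rewrite natrM -scalerA (scalerAr l%:R) scalerAl.
  exact: gen_ring_mul.
Qed.

Lemma cl_der_eq0 (x : CV) : (forall v, cl_der v x = 0) -> exists a : rat, x = a%:A.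
Proof.
move=> dx0; have [k k0 /order_der_eq0] := clear_denominators x.
case=> [i|a _ xa]; first by rewrite cl_derZ dx0 scaler0.
exists (k%:R^-1 * a); rewrite -scalerA -xa scalerA mulVf ?scale1r //.
by rewrite pnatr_eq0.
Qed.

End RootOrder.

(** * Inverse Cartan matrices, highest roots and diagram automorphisms *)

(** Integer data indexed by plain natural numbers, so that the checks below evaluate on closed
    terms. *)
Definition cartanz (t : ade) (n i j : nat) : int :=
  if i == j then 2
  else if dynkin_edge t n i j || dynkin_edge t n j i then -1 else 0.

Definition sumz (n : nat) (f : nat -> int) : int :=
  foldr (fun k s => f k + s) 0 (iota 0 n).

Definition disc (t : ade) (n : nat) : nat :=
  match t with TypeA => n.+1 | TypeD => 4 | TypeE => 9 - n end.

Definition weightE (n : nat) : seq (seq nat) :=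
  match n with
  | 6 => [:: [:: 4; 3; 5; 6; 4; 2]; [:: 3; 6; 6; 9; 6; 3];
             [:: 5; 6; 10; 12; 8; 4]; [:: 6; 9; 12; 18; 12; 6];
             [:: 4; 6; 8; 12; 10; 5]; [:: 2; 3; 4; 6; 5; 4]]
  | 7 => [:: [:: 4; 4; 6; 8; 6; 4; 2]; [:: 4; 7; 8; 12; 9; 6; 3];
             [:: 6; 8; 12; 16; 12; 8; 4]; [:: 8; 12; 16; 24; 18; 12; 6];
             [:: 6; 9; 12; 18; 15; 10; 5]; [:: 4; 6; 8; 12; 10; 8; 4];
             [:: 2; 3; 4; 6; 5; 4; 3]]
  | _ => [:: [:: 4; 5; 7; 10; 8; 6; 4; 2]; [:: 5; 8; 10; 15; 12; 9; 6; 3];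
             [:: 7; 10; 14; 20; 16; 12; 8; 4]; [:: 10; 15; 20; 30; 24; 18; 12; 6];
             [:: 8; 12; 16; 24; 20; 15; 10; 5]; [:: 6; 9; 12; 18; 15; 12; 8; 4];
             [:: 4; 6; 8; 12; 10; 8; 6; 3]; [:: 2; 3; 4; 6; 5; 4; 3; 2]]
  end%N.

(* The entries of the inverse Cartan matrix times its determinant [disc t n],
   i.e. [disc t n] times the inner products of the fundamental weights *)
Definition weightz (t : ade) (n i j : nat) : nat :=
  match t with
  | TypeA => (minn i j).+1 * (n - maxn i j)
  | TypeD => if maxn i j < n - 2 then 4 * (minn i j).+1
             else if minn i j < n - 2 then 2 * (minn i j).+1
             else if i == j then n else n - 2
  | TypeE => nth 0 (nth [::] (weightE n) i) j
  end%N.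

(** The coefficients of the highest root on the simple roots. *)
Definition markz (t : ade) (n : nat) : seq int :=
  match t with
  | TypeA => nseq n 1
  | TypeD => 1 :: nseq (n - 3) 2 ++ [:: 1; 1]
  | TypeE => match n with
             | 6%N => [:: 1; 2; 2; 3; 2; 1]
             | 7%N => [:: 2; 2; 3; 4; 3; 2; 1]
             | _ => [:: 2; 3; 4; 6; 5; 4; 3; 2]
             end
  end.

Definition pairz t n (v : seq int) i := sumz n (fun k => v`_k * cartanz t n k i).

(* One step of the ascent of a root towards the highest root: reflect in a
   simple root of negative pairing. *)
Definition climb t n (v : seq int) : seq int :=
  if [seq i <- iota 0 n | pairz t n v i < 0] is i :: _
  then set_nth 0 v i (v`_i - pairz t n v i) else v.

(* The first [k] values of the maps of the diagram that preserve the Cartan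
   matrix. *)
Fixpoint diagram_maps t n k : seq (seq nat) :=
  if k is k'.+1 then
    flatten [seq [seq rcons s x | x <- iota 0 n
                     & all (fun j => cartanz t n (nth 0%N s j) x == cartanz t n j k')
                         (iota 0 k')] | s <- diagram_maps t n k']
  else [:: [::]].

Definition all_lt n (p : pred nat) := all p (iota 0 n).

Lemma all_ltP n (p : pred nat) : reflect (forall i : 'I_n, p i) (all_lt n p).
Proof.
apply: (iffP allP) => [h i|h k]; first by apply: h; rewrite mem_iota /=.
by rewrite mem_iota => /= kn; apply: (h (Ordinal kn)).
Qed.

Definition check_inverse t n := all_lt n (fun i => all_lt n (fun j =>
  sumz n (fun k => (weightz t n i k)%:Z * cartanz t n k j)
  == if i == j then (disc t n)%:Z else 0)).

(** Multiplied by [disc]: inner products of fundamental weights against twice the products of marks,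
    the comparison that singles out f1 among dominant isotropic vectors. A tight entry must be
    diagonal, with a weight outside the root lattice, that is, a row not divisible by [disc]. *)
Definition check_weight t n := all_lt n (fun i => all_lt n (fun j =>
  let g := (weightz t n i j)%:Z in
  let b := 2 * (disc t n)%:Z * (markz t n)`_i * (markz t n)`_j in
  [&& 0 < g, g <= b & (g == b) ==> (i == j) &&
     ~~ all_lt n (fun k => disc t n %| weightz t n i k)%N])).

(** A step raises the height of a root by at least 1 and stops at a dominant one. The largest
    height, reached in E_8, is 29, so 30 rounds are enough for every type. *)
Definition check_mark t n := all_lt n (fun i =>
  [&& 0 < (markz t n)`_i, 0 <= pairz t n (markz t n) i
    & iter 30 (climb t n) [seq (k == i)%:Z | k <- iota 0 n] == markz t n]).

(** Two weights are congruent modulo the root lattice when their rows agree modulo [disc]; so a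
    nontrivial diagram map has to move a class of the discriminant group. *)
Definition check_diagram t n := all (fun s => (s == iota 0 n) ||
  ~~ all_lt n (fun i => all_lt n (fun j =>
    weightz t n (nth 0 s i) j == weightz t n i j %[mod disc t n])%N))
  (diagram_maps t n n).

Definition check t n :=
  [&& (0 < disc t n)%N, check_inverse t n, check_weight t n, check_mark t n
    & check_diagram t n].

(** Everything special to the thirteen types is established by this computation. *)
Lemma listed_type_check t n : listed_type t n -> check t n.
Proof.
have cA : all (check TypeA) (iota 1 6) by vm_compute.
have cD : all (check TypeD) (iota 5 4) by vm_compute.
have cE : all (check TypeE) (iota 6 3) by vm_compute.
by case: t => h; [move/allP: cA|move/allP: cD|move/allP: cE]; apply;
  rewrite mem_iota.
Qed.

Lemma sumzE n (f : nat -> int) : \sum_(k < n) (f k)%:~R = (sumz n f)%:~R :> rat.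
Proof.
rewrite -(big_mkord xpredT (fun k => (f k)%:~R)) /index_iota subn0 /sumz.
elim: (iota 0 n) => [|k s IHs] /=; first by rewrite big_nil.
by rewrite big_cons IHs intrD.
Qed.

Lemma frac_int (d a : nat) : (0 < d)%N -> (a%:R / d%:R : rat) \is a Num.int -> (d %| a)%N.
Proof.
move=> d0 /intrP[z e]; have {e}: (a%:R : rat) = z%:~R * d%:R.
  by rewrite -e divfK // pnatr_eq0 -lt0n.
rewrite -[d%:R]/((d%:Z)%:~R) -[a%:R]/((a%:Z)%:~R) -intrM => /intr_inj e.
by apply/dvdnP; exists `|z|%N; rewrite -[d in RHS]/`|d%:Z|%N -abszM -e.
Qed.

Lemma frac_sub_int (d a b : nat) : (0 < d)%N ->
  (a%:R / d%:R - b%:R / d%:R : rat) \is a Num.int -> a = b %[mod d].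
Proof.
move=> d0; wlog ba : a b / (b <= a)%N.
  move=> W; case/orP: (leq_total b a) => h; first exact: W.
  by rewrite -rpredN opprB => /(W _ _ h) ->.
rewrite -mulrBl -natrB // => /(frac_int d0) h; apply/eqP.
by rewrite eqn_mod_dvd.
Qed.

Section Data.
Variables (t : ade) (n : nat).
Hypothesis Htn : listed_type t n.
Local Notation V := 'rV[rat]_n.
Local Notation alpha := (@simple_root n).
Local Notation C := (cartan t n).
Local Notation kappa := (@Defs.kappa t n).

Definition weight_gram : 'M[rat]_n :=
  \matrix_(i, j) ((weightz t n i j)%:R / (disc t n)%:R).
Local Notation G := weight_gram.

Definition seq_vec (s : seq int) : V := \row_i (s`_i)%:~R.
Definition marks : V := seq_vec (markz t n).

Let disc_gt0 : (0 < disc t n)%N.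
Proof. by case/and5P: (listed_type_check Htn). Qed.

Let disc_gt0R : 0 < (disc t n)%:R :> rat.
Proof. by rewrite ltr0n. Qed.

Let disc_neq0 : (disc t n)%:R != 0 :> rat.
Proof. by rewrite gt_eqF. Qed.

Lemma cartanE (i j : 'I_n) : C i j = (cartanz t n i j)%:~R.
Proof.
rewrite mxE /cartanz -(inj_eq val_inj) /=; case: ifP => // _.
by case: ifP => // _; rewrite mulrN1z.
Qed.

Lemma weight_gram_cartan : G *m C = 1%:M.
Proof.
apply/matrixP => i j; case/and5P: (listed_type_check Htn) => _ + _ _ _.
move=> /all_ltP/(_ i)/all_ltP/(_ j)/eqP e.
apply: (mulfI disc_neq0); rewrite !mxE big_distrr /=.
under eq_bigr => k _ do rewrite mxE cartanE mulrA (mulrC _%:R) divfK // -[_%:R]/((_%:Z)%:~R) -intrM.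
rewrite (sumzE n (fun k => (weightz t n i k)%:Z * cartanz t n k j)) e -(inj_eq val_inj) /=.
by case: eqP => _; rewrite ?mulr1 ?mulr0.
Qed.

Lemma weight_gram_check (i j : 'I_n) :
  [/\ 0 < G i j, G i j <= 2 * marks 0 i * marks 0 j &
      G i j = 2 * marks 0 i * marks 0 j -> i = j /\ ~ intv (row i G)].
Proof.
case/and5P: (listed_type_check Htn) => _ _ + _ _.
move=> /all_ltP/(_ i)/all_ltP/(_ j); cbv zeta; case/and3P=> g0 gb geq.
have -> : 2 * marks 0 i * marks 0 j =
    (2 * (disc t n)%:Z * (markz t n)`_i * (markz t n)`_j)%:~R / (disc t n)%:R.
  apply: (mulIf disc_neq0); rewrite divfK // !mxE !intrM -[(disc t n)%:R]/((disc t n)%:Z%:~R).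
  by ring.
rewrite [G i j]mxE -[(weightz _ _ _ _)%:R]/((weightz t n i j)%:Z%:~R); split.
- by rewrite divr_gt0 // ltr0z.
- by rewrite ler_pM2r ?invr_gt0 // ler_int.
move/(mulIf (invr_neq0 disc_neq0))/intr_inj => e.
move: geq; rewrite e eqxx /= => /andP[/eqP ij /negP h]; split; first exact: val_inj.
move=> hi; apply: h; apply/all_ltP => k; have := hi k; rewrite !mxE.
exact: frac_int.
Qed.

Lemma marks_gt0 i : 0 < marks 0 i.
Proof.
case/and5P: (listed_type_check Htn) => _ _ _ + _.
by move=> /all_ltP/(_ i)/and3P[h _ _]; rewrite mxE ltr0z.
Qed.

Lemma pairzE (s : seq int) (i : 'I_n) :
  kappa (seq_vec s) (alpha i) = (pairz t n s i)%:~R.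
Proof.
rewrite kappa_simple mxE /pairz -sumzE; apply: eq_bigr => k _.
by rewrite mxE cartanE intrM.
Qed.

Lemma marks_dominant i : 0 <= kappa marks (alpha i).
Proof.
case/and5P: (listed_type_check Htn) => _ _ _ + _.
by move=> /all_ltP/(_ i)/and3P[_ h _]; rewrite pairzE ler0z.
Qed.

Lemma climb_vec s : seq_vec (climb t n s) = seq_vec s \/
  exists i, seq_vec (climb t n s)
            = seq_vec s - kappa (seq_vec s) (alpha i) *: alpha i.
Proof.
rewrite /climb; case e: filter => [|i r]; [by left|right].
have : i \in [seq i <- iota 0 n | pairz t n s i < 0] by rewrite e mem_head.
rewrite mem_filter mem_iota add0n => /andP[_ /= ltin].
exists (Ordinal ltin); apply/rowP => j.
rewrite pairzE !mxE nth_set_nth /= -(inj_eq val_inj) /=; case: eqP => [->|_].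
  by rewrite mulr1 intrB.
by rewrite mulr0 subr0.
Qed.

(** The ascent from a simple root to the highest root is a chain of simple reflections, which are
    involutions, so an invariant property passes both ways. It transports the norm, being a root,
    and membership of affine reflections in the Weyl group. *)
Lemma marks_orbit (P : V -> Prop) :
  (forall i v, P v -> P (v - kappa v (alpha i) *: alpha i)) ->
  forall i, P (alpha i) <-> P marks.
Proof.
move=> Pr i; case/and5P: (listed_type_check Htn) => _ _ _ + _.
move=> /all_ltP/(_ i)/and3P[_ _ /eqP e].
have <- : seq_vec [seq (k == i :> nat)%:Z | k <- iota 0 n] = alpha i.
  apply/rowP=> j; rewrite !mxE eqxx (nth_map 0%N) ?size_iota // nth_iota //.
rewrite /marks -e; move: (map _ _) => s; elim: 30%N s => //= k IHk s.
have Pr' j v : P (v - kappa v (alpha j) *: alpha j) -> P v.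
  move=> /(Pr j); rewrite kappaBl kappaZl kappa_simple2 cartan_diag.
  set a := kappa v _; rewrite -addrA -opprD -scalerDl.
  have -> : a + (a - a * 2) = 0 by ring.
  by rewrite scale0r subr0.
have st u : P (seq_vec u) <-> P (seq_vec (climb t n u)).
  case: (climb_vec u) => [->//|[j ->]]; split; [exact: Pr|exact: Pr'].
rewrite -st; exact: IHk.
Qed.

Lemma diagram_mapsP (s : nat -> nat) k : (k <= n)%N ->
  (forall i, (i < n)%N -> (s i < n)%N) ->
  (forall i j, (i < n)%N -> (j < n)%N -> cartanz t n (s i) (s j) = cartanz t n i j) ->
  map s (iota 0 k) \in diagram_maps t n k.
Proof.
move=> + sn sc; elim: k => // k IHk kn.
have -> : map s (iota 0 k.+1) = rcons (map s (iota 0 k)) (s k).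
  by rewrite -addn1 iotaD map_cat cats1.
apply/flattenP; exists [seq rcons (map s (iota 0 k)) x | x <- iota 0 n
     & all (fun j => cartanz t n (nth 0%N (map s (iota 0 k)) j) x == cartanz t n j k)
          (iota 0 k)].
  by apply/mapP; exists (map s (iota 0 k)) => //; apply/IHk/ltnW.
apply/mapP; exists (s k) => //.
rewrite mem_filter mem_iota sn // !andbT; apply/allP => j.
rewrite mem_iota => /= jk; rewrite (nth_map 0%N) ?size_iota // nth_iota // add0n.
by rewrite sc //; apply: ltn_trans kn.
Qed.

Lemma diagram_rigid (s : 'I_n -> 'I_n) :
  (forall i j, C (s i) (s j) = C i j) ->
  (forall i j, G (s i) j - G i j \is a Num.int) -> forall i, s i = i.
Proof.
move=> sc sg; pose s' k := oapp (fun i => s i : nat) 0%N (insub k : option 'I_n).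
have s'E (i : 'I_n) : s' i = s i by rewrite /s' valK.
have s'i : map s' (iota 0 n) \in diagram_maps t n n.
  apply: diagram_mapsP => // [k kn|k l kn ln].
    by rewrite (s'E (Ordinal kn)).
  by have := sc (Ordinal kn) (Ordinal ln); rewrite !cartanE -!s'E => /intr_inj.
case/and5P: (listed_type_check Htn) => _ _ _ _ /allP/(_ _ s'i).
case/orP.
  move=> /eqP e i; apply: val_inj; rewrite /= -s'E.
  have := congr1 (nth 0%N ^~ i) e; rewrite (nth_map 0%N) ?size_iota // nth_iota //.
case/negP; apply/all_ltP => i; apply/all_ltP => j.
rewrite (nth_map 0%N) ?size_iota // nth_iota // add0n s'E.
by have := sg i j; rewrite !mxE => /(frac_sub_int disc_gt0)/eqP.
Qed.

End Data.

(** * The finite root lattice *)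

Section FiniteForm.
Variables (t : ade) (n : nat).
Hypothesis Htn : listed_type t n.
Local Notation V := 'rV[rat]_n.
Local Notation alpha := (@simple_root n).
Local Notation C := (cartan t n).
Local Notation kappa := (@Defs.kappa t n).
Local Notation G := (weight_gram t n).

Let GC : G *m C = 1%:M := weight_gram_cartan Htn.

Lemma cartan_weight_gram : C *m G = 1%:M.
Proof. exact: mulmx1C GC. Qed.

Lemma kappaE u v : kappa u v = \sum_i \sum_j u 0 i * C i j * v 0 j.
Proof.
rewrite /Defs.kappa mxE exchange_big /=; apply: eq_bigr => j _.
by rewrite !mxE mulr_suml.
Qed.

Lemma kappa_coord u v : kappa u v = \sum_i kappa u (alpha i) * v 0 i.
Proof.
rewrite [LHS]/Defs.kappa mxE; apply: eq_bigr => j _.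
by rewrite kappa_simple [_^T _ _]mxE.
Qed.

Lemma kappa_weights v : kappa v v =
  \sum_i \sum_j kappa v (alpha i) * kappa v (alpha j) * G i j.
Proof.
rewrite kappa_coord exchange_big; apply: eq_bigr => i _.
have -> : v 0 i = \sum_j kappa v (alpha j) * G j i.
  have {1}-> : v = v *m C *m G by rewrite -mulmxA cartan_weight_gram mulmx1.
  by rewrite mxE; apply: eq_bigr => j _; rewrite kappa_simple.
by rewrite mulr_sumr; apply: eq_bigr => j _; rewrite mulrCA mulrA.
Qed.

Lemma cartan_off i j : i != j -> C i j <= 0.
Proof. by move=> /negbTE ij; rewrite mxE ij; case: ifP. Qed.

Definition weyl_vec : V := \row_j \sum_i G i j.

Lemma rho_gt0 i : 0 < weyl_vec 0 i.
Proof.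
rewrite mxE (bigD1 i) //= ltr_wpDr //; last by case: (weight_gram_check Htn i i).
by apply: sumr_ge0 => j _; case: (weight_gram_check Htn j i) => /ltW.
Qed.

Lemma kappa_rho v : kappa weyl_vec v = \sum_i v 0 i.
Proof.
have -> : weyl_vec = \sum_i weight G i.
  by apply/rowP => j; rewrite mxE summxE; apply: eq_bigr => i _; rewrite [RHS]mxE.
by rewrite kappa_suml; apply: eq_bigr => i _; rewrite (kappa_weight GC).
Qed.

Lemma kappa_rho_simple i : kappa weyl_vec (alpha i) = 1.
Proof.
rewrite kappa_rho (bigD1 i) //= mxE !eqxx big1 ?addr0 // => j ji.
by rewrite mxE (negbTE ji) andbF.
Qed.

Lemma rho_dual : dualv t weyl_vec.
Proof. by apply/dualvP => i; rewrite kappa_rho_simple. Qed.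

(* Since [C weyl_vec = 1 > 0], AM-GM on the off-diagonal terms bounds the form below
   by a diagonal one. *)
Lemma kappa_lower (v : V) : \sum_i (v 0 i) ^+ 2 / weyl_vec 0 i <= kappa v v.
Proof.
pose a i j := C i j * weyl_vec 0 j * (v 0 i ^+ 2 / weyl_vec 0 i).
have rn0 i : weyl_vec 0 i != 0 by rewrite gt_eqF // rho_gt0.
have Cr i : \sum_j C i j * weyl_vec 0 j = 1.
  rewrite -(kappa_rho_simple i) kappaC /Defs.kappa -rowE mxE.
  by apply: eq_bigr => j _; rewrite [row i _ _ _]mxE [_^T _ _]mxE.
have Csym i j : C i j = C j i by rewrite -[in LHS](cartan_tr t n) mxE.
have e : \sum_i (v 0 i) ^+ 2 / weyl_vec 0 i = \sum_i \sum_j (a i j + a j i) / 2.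
  have s1 : \sum_i \sum_j a i j = \sum_i (v 0 i) ^+ 2 / weyl_vec 0 i.
    by apply: eq_bigr => i _; rewrite -mulr_suml Cr mul1r.
  under [RHS]eq_bigr => i _ do rewrite -mulr_suml big_split /=.
  rewrite -mulr_suml big_split /= [X in _ + X]exchange_big /= s1.
  by field.
rewrite e kappaE; apply: ler_sum => i _; apply: ler_sum => j _.
rewrite /a (Csym j i).
case: (eqVneq i j) => [->|ij].
  by rewrite le_eqVlt; apply/orP; left; apply/eqP; field.
have c0 := cartan_off ij; have ri := rho_gt0 i; have rj := rho_gt0 j.
rewrite -subr_ge0 (_ : _ - _ = - C i j / (2 * weyl_vec 0 i * weyl_vec 0 j) *
   (v 0 i * weyl_vec 0 j - v 0 j * weyl_vec 0 i) ^+ 2); last by field; rewrite !rn0.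
apply: mulr_ge0; last exact: sqr_ge0.
by rewrite divr_ge0 ?oppr_ge0 // !mulr_ge0 // ltW.
Qed.

Lemma kappa_ge0 v : 0 <= kappa v v.
Proof.
apply: le_trans (kappa_lower v); apply: sumr_ge0 => i _.
by rewrite divr_ge0 ?sqr_ge0 // ltW // rho_gt0.
Qed.

Lemma kappa_eq0 v : kappa v v = 0 -> v = 0.
Proof.
move=> v0; apply/rowP => i; rewrite [RHS]mxE.
have := kappa_lower v; rewrite v0 => le0.
have ge i0 : 0 <= (v 0 i0) ^+ 2 / weyl_vec 0 i0.
  by rewrite divr_ge0 ?sqr_ge0 // ltW // rho_gt0.
have /eqP : \sum_i (v 0 i) ^+ 2 / weyl_vec 0 i = 0.
  by apply/eqP; rewrite eq_le le0 sumr_ge0.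
rewrite psumr_eq0 => [/allP/(_ i (mem_index_enum _))|//] /=.
by rewrite mulf_eq0 invr_eq0 (gt_eqF (rho_gt0 i)) orbF sqrf_eq0 => /eqP.
Qed.

Lemma kappa_int u v : dualv t u -> intv v -> kappa u v \is a Num.int.
Proof.
move=> ud vi; rewrite kappa_coord rpred_sum // => i _.
by rewrite rpredM //; move/dualvP: ud.
Qed.

Lemma kappa_even v : intv v -> kappa v v / 2 \is a Num.int.
Proof.
move=> vi; suff [_] : intv v /\ kappa v v / 2 \is a Num.int by [].
rewrite {1 2 3}(row_sum_simple v); elim/big_ind: _ => [|x y [xi xe] [yi ye]|i _].
- by rewrite -(scale0r 0) kappaZl mul0r mul0r; split=> // i; rewrite scale0r mxE.
- split; first by move=> i; rewrite mxE rpredD.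
  rewrite kappaDl !kappaDr (kappaC t y x) (_ : _ / 2 = kappa x x / 2 + kappa y y / 2 + kappa x y); last by field.
  by rewrite !rpredD // kappa_int //; apply: intv_dual.
- split; first by move=> j; rewrite mxE rpredM // simple_root_int.
  by rewrite kappaZl kappaZr kappa_simple2 cartan_diag mulrA mulfK ?rpredM.
Qed.

Lemma kappa_ge2 v : intv v -> v <> 0 -> 2 <= kappa v v.
Proof.
move=> vi v0; have := norm_intr_ge1 (kappa_even vi).
have k0 := kappa_ge0 v; rewrite ger0_norm ?divr_ge0 // ler_pdivlMr // mul1r; apply.
by rewrite mulf_neq0 //; apply/eqP => /kappa_eq0.
Qed.

(** The positive and negative parts of [v] have disjoint supports, so they pair to at most 0. Each
    nonzero part has norm at least 2, and two of them would give [v] norm at least 4. *)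
Lemma norm2_sign v : intv v -> kappa v v = 2 ->
  (forall i, 0 <= v 0 i) \/ (forall i, v 0 i <= 0).
Proof.
move=> vi v2; pose p : V := \row_i Num.max (v 0 i) 0; pose m := p - v.
have pi : intv p by move=> i; rewrite mxE; case: (lerP (v 0 i) 0); rewrite ?rpred0.
have mi : intv m by move=> i; rewrite [m _ _]mxE [(- v) _ _]mxE rpredB // pi.
have pE i : p 0 i = Num.max (v 0 i) 0 by rewrite mxE.
have mE i : m 0 i = Num.max (v 0 i) 0 - v 0 i by rewrite !mxE.
have pm : kappa p m <= 0.
  rewrite kappaE; apply: sumr_le0 => i _; apply: sumr_le0 => j _.
  rewrite pE mE; case: (eqVneq i j) => [->|/cartan_off c0].
    by case: (lerP (v 0 j) 0) => h; rewrite ?subrr ?mul0r ?mulr0.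
  rewrite mulrAC; apply: mulr_ge0_le0 => //.
  by apply: mulr_ge0; rewrite ?subr_ge0 le_max lexx ?orbT.
have vE : v = p - m by rewrite /m opprB addrC subrK.
have e : kappa v v = kappa p p + kappa m m - 2 * kappa p m.
  by rewrite /m !kappaBl !kappaBr (kappaC t v p); ring.
case: (pselect (p = 0)) => [p0|/(kappa_ge2 pi) p2].
  right=> i; rewrite vE p0 sub0r mxE oppr_le0 mE subr_ge0 le_max lexx //.
case: (pselect (m = 0)) => [m0|/(kappa_ge2 mi) m2].
  by left=> i; rewrite vE m0 subr0 pE le_max lexx orbT.
by exfalso; move: v2; rewrite e; lra.
Qed.

Lemma int_sum_eq1 (I : finType) (f : I -> rat) :
  (forall i, f i \is a Num.int) -> (forall i, 0 <= f i) -> \sum_i f i = 1 ->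
  exists i, forall j, f j = (j == i)%:R.
Proof.
move=> fi f0 s1; have [i fin0] : exists i, f i != 0.
  apply: contrapT => h; move: s1; rewrite big1 => [/eqP|i _]; first by rewrite eq_sym oner_eq0.
  by apply/eqP; apply: contrapT => /negP e; apply: h; exists i.
have fi1 : 1 <= f i by have := norm_intr_ge1 (fi i) fin0; rewrite ger0_norm.
exists i; have s0 : 0 <= \sum_(j | j != i) f j by apply: sumr_ge0.
move: s1; rewrite (bigD1 i) //= => s1.
have fi1' : f i = 1 by lra.
have /eqP : \sum_(j | j != i) f j = 0 by lra.
rewrite psumr_eq0 // => /allP h j; case: eqVneq => [->//|ji].
by have := h j (mem_index_enum _); rewrite ji => /eqP.
Qed.

(** Recognises the simple roots by norm and height alone, so that an isometry of the lattice fixing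
    [weyl_vec] must permute them. *)
Lemma norm2_height1 v : intv v -> kappa v v = 2 -> kappa weyl_vec v = 1 ->
  exists i, v = alpha i.
Proof.
move=> vi v2; rewrite kappa_rho => s1.
have v0 : forall i, 0 <= v 0 i.
  case: (norm2_sign vi v2) => // v0; have : \sum_i v 0 i <= 0 by apply: sumr_le0.
  by rewrite s1 ler10.
have [i h] := int_sum_eq1 vi v0 s1; exists i; apply/rowP => j.
by rewrite h mxE eqxx eq_sym /=.
Qed.

(** Regularity of the Weyl vector: for an isometric image of it, dominance and integrality then
    force pairings at least 1 with the simple roots. *)
Lemma norm2_height0 v : intv v -> kappa v v = 2 -> kappa weyl_vec v <> 0.
Proof.
move=> vi v2; rewrite kappa_rho => s0.
suff v0 : v = 0 by move: v2; rewrite v0 -(scale0r 0) kappaZl mul0r.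
apply/rowP => i; rewrite [RHS]mxE; case: (norm2_sign vi v2) => h.
  move/eqP: s0; rewrite psumr_eq0 // => /allP/(_ i (mem_index_enum _))/=.
  by move/eqP.
have /eqP : \sum_i - v 0 i = 0 by rewrite sumrN s0 oppr0.
rewrite psumr_eq0 => [/allP/(_ i (mem_index_enum _))|j _]; last by rewrite oppr_ge0.
by rewrite /= oppr_eq0 => /eqP.
Qed.

(** With [c i] the pairings of [v], the two norms differ by the sum of [(c i * c j - 1) * G i j].
    All terms are nonnegative and [G] has positive entries, so every [c i] is 1. *)
Lemma rho_unique v : dualv t v -> kappa v v = kappa weyl_vec weyl_vec ->
  (forall i, 1 <= kappa v (alpha i)) -> v = weyl_vec.
Proof.
move=> vd vr v1.
have g0 i j : 0 < G i j by case: (weight_gram_check Htn i j).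
have e : \sum_i \sum_j (kappa v (alpha i) * kappa v (alpha j) - 1) * G i j = 0.
  transitivity (kappa v v - kappa weyl_vec weyl_vec); last by rewrite vr subrr.
  rewrite !kappa_weights -sumrB; apply: eq_bigr => i _; rewrite -sumrB.
  by apply: eq_bigr => j _; rewrite !kappa_rho_simple; ring.
have t0 i j : 0 <= (kappa v (alpha i) * kappa v (alpha j) - 1) * G i j.
  apply: mulr_ge0; last exact: ltW.
  by have := v1 i; have := v1 j; nra.
have c1 i : kappa v (alpha i) = 1.
  move/eqP: e; rewrite psumr_eq0 => [|k _]; last by apply: sumr_ge0.
  move=> /allP/(_ i (mem_index_enum _)); rewrite psumr_eq0 //.
  move=> /allP/(_ i (mem_index_enum _)) /=; rewrite mulf_eq0 (gt_eqF (g0 _ _)) orbF => /eqP.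
  by have := v1 i; nra.
have -> : v = v *m C *m G by rewrite -mulmxA cartan_weight_gram mulmx1.
have -> : weyl_vec = weyl_vec *m C *m G by rewrite -mulmxA cartan_weight_gram mulmx1.
by congr (_ *m _); apply/rowP => i; rewrite -!kappa_simple c1 kappa_rho_simple.
Qed.

End FiniteForm.

(** * The Lorentzian lattice *)

Section LorentzLattice.
Variables (t : ade) (n : nat).
Hypothesis Htn : listed_type t n.
Local Notation V := 'rV[rat]_n.
Local Notation U := (vahlen_space V).
Local Notation alpha := (@simple_root n).
Local Notation C := (cartan t n).
Local Notation kappa := (@Defs.kappa t n).
Local Notation G := (weight_gram t n).
Local Notation theta0 := (marks t n).
Implicit Types (x y z X Y : U) (v q : V) (w g : U -> U).

Definition lc1 (x : U) : rat := x.2 0 0.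
Definition lc2 (x : U) : rat := x.2 0 1.
Definition mkU (v : V) (a b : rat) : U :=
  (v, \row_(j < 2) if j == 0 then a else b).

Lemma mkU1 v a b : (mkU v a b).1 = v. Proof. by []. Qed.
Lemma mkUl1 v a b : lc1 (mkU v a b) = a. Proof. by rewrite /lc1 mxE. Qed.
Lemma mkUl2 v a b : lc2 (mkU v a b) = b. Proof. by rewrite /lc2 mxE. Qed.
Definition mkUE := (mkU1, mkUl1, mkUl2).

Lemma addU1 x y : (x + y).1 = x.1 + y.1. Proof. by []. Qed.
Lemma addUl1 x y : lc1 (x + y) = lc1 x + lc1 y. Proof. by rewrite /lc1 mxE. Qed.
Lemma addUl2 x y : lc2 (x + y) = lc2 x + lc2 y. Proof. by rewrite /lc2 mxE. Qed.
Lemma oppU1 x : (- x).1 = - x.1. Proof. by []. Qed.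
Lemma oppUl1 x : lc1 (- x) = - lc1 x. Proof. by rewrite /lc1 mxE. Qed.
Lemma oppUl2 x : lc2 (- x) = - lc2 x. Proof. by rewrite /lc2 mxE. Qed.
Lemma scaleU1 a x : (a *: x).1 = a *: x.1. Proof. by []. Qed.
Lemma scaleUl1 a x : lc1 (a *: x) = a * lc1 x. Proof. by rewrite /lc1 mxE. Qed.
Lemma scaleUl2 a x : lc2 (a *: x) = a * lc2 x. Proof. by rewrite /lc2 mxE. Qed.
Definition UE := (mkUE, addU1, addUl1, addUl2, oppU1, oppUl1, oppUl2, scaleU1,
  scaleUl1, scaleUl2).

Lemma U_ext x y : x.1 = y.1 -> lc1 x = lc1 y -> lc2 x = lc2 y -> x = y.
Proof.
case: x y => [v a] [u b]; rewrite /lc1 /lc2 /= => -> e0 e1; congr pair.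
by apply/rowP => i; case: (ord2 i) => ->.
Qed.

Lemma mkU_eta x : x = mkU x.1 (lc1 x) (lc2 x).
Proof. by apply: U_ext; rewrite !mkUE. Qed.

(* Twice the form of W, so that the simple roots have norm 2 and the root
   lattice of C^++ is even. *)
Definition lform (x y : U) : rat :=
  kappa x.1 y.1 - (lc1 x * lc2 y + lc2 x * lc1 y).
Local Notation K := lform.

Lemma lformDl x y z : K (x + y) z = K x z + K y z.
Proof. by rewrite /K !UE kappaDl; ring. Qed.
Lemma lformZl a x z : K (a *: x) z = a * K x z.
Proof. by rewrite /K !UE kappaZl; ring. Qed.
Lemma lformC x z : K x z = K z x.
Proof. by rewrite /K kappaC; ring. Qed.
Lemma lformDr x y z : K z (x + y) = K z x + K z y.
Proof. by rewrite !(lformC z) lformDl. Qed.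
Lemma lformZr a x z : K z (a *: x) = a * K z x.
Proof. by rewrite !(lformC z) lformZl. Qed.
Lemma lformNl x z : K (- x) z = - K x z.
Proof. by rewrite -scaleN1r lformZl mulN1r. Qed.
Lemma lformNr x z : K z (- x) = - K z x.
Proof. by rewrite !(lformC z) lformNl. Qed.
Definition lformE := (lformDl, lformNl, lformZl, lformDr, lformNr, lformZr).

Definition intU x := [/\ intv x.1, lc1 x \is a Num.int & lc2 x \is a Num.int].
(** The hyperbolic plane is unimodular for [lform], so only the finite component differs from
    [intU]. *)
Definition lor_dual x := [/\ dualv t x.1, lc1 x \is a Num.int & lc2 x \is a Num.int].

Lemma intvD u v : intv u -> intv v -> intv (u + v).
Proof. by move=> ui vi i; rewrite mxE rpredD. Qed.
Lemma intvZ a v : a \is a Num.int -> intv v -> intv (a *: v).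
Proof. by move=> ai vi i; rewrite mxE rpredM. Qed.
Lemma intUD x y : intU x -> intU y -> intU (x + y).
Proof.
by move=> [x1 xa xb] [y1 ya yb]; split; rewrite !UE ?rpredD //; apply: intvD.
Qed.
Lemma intUZ a x : a \is a Num.int -> intU x -> intU (a *: x).
Proof.
by move=> ai [x1 xa xb]; split; rewrite !UE ?rpredM //; apply: intvZ.
Qed.
Lemma intU_dual x : intU x -> lor_dual x.
Proof. by case=> *; split=> //; apply: intv_dual. Qed.
Lemma dualUD x y : lor_dual x -> lor_dual y -> lor_dual (x + y).
Proof.
move=> [x1 xa xb] [y1 ya yb]; split; rewrite !UE ?rpredD //.
by rewrite /dualv mulmxDl; apply: intvD.
Qed.

Lemma lform_int x y : lor_dual x -> intU y -> K x y \is a Num.int.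
Proof.
by move=> [x1 xa xb] [y1 ya yb]; rewrite rpredB ?kappa_int // rpredD // rpredM.
Qed.

Definition lor_refl X x : U := x - K x X *: X.

(* Isometries acting trivially on the discriminant group. *)
Definition lor_iso g := [/\ linear g, forall x y, K (g x) (g y) = K x y
  & forall y, lor_dual y -> intU (g y - y)].

Lemma lat_iso_comp g h : lor_iso g -> lor_iso h -> lor_iso (g \o h).
Proof.
move=> [gl gK gd] [hl hK hd]; split=> [a x y|x y|y yd] /=.
- by rewrite hl gl.
- by rewrite gK hK.
have hy : lor_dual (h y).
  by rewrite -(subrK y (h y)); apply: dualUD => //; apply/intU_dual/hd.
by rewrite -(subrK (h y) (g (h y))) -addrA; apply: intUD; [apply: gd|apply: hd].
Qed.

Lemma lat_iso_dual g y : lor_iso g -> lor_dual y -> lor_dual (g y).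
Proof.
move=> [_ _ gd] yd; rewrite -(subrK y (g y)); apply: dualUD => //.
exact/intU_dual/gd.
Qed.

Lemma lat_iso_int g y : lor_iso g -> intU y -> intU (g y).
Proof.
move=> [_ _ gd] yi; rewrite -(subrK y (g y)); apply: intUD => //.
exact/gd/intU_dual.
Qed.

Lemma refl_linear X : linear (lor_refl X).
Proof.
move=> a x y.
by rewrite /lor_refl !lformE scalerDl opprD addrACA scalerBr scalerA.
Qed.

Lemma reflK X : K X X = 2 -> involutive (lor_refl X).
Proof.
move=> X2 x; rewrite /lor_refl !lformE X2 -addrA -opprD -scalerDl.
have -> : K x X + (K x X - K x X * 2) = 0 by ring.
by rewrite scale0r subr0.
Qed.

Lemma refl_form X x y : K X X = 2 -> K (lor_refl X x) (lor_refl X y) = K x y.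
Proof. by move=> X2; rewrite /lor_refl !lformE X2 (lformC X y); ring. Qed.

Lemma refl_iso X : K X X = 2 -> intU X -> lor_iso (lor_refl X).
Proof.
move=> X2 Xi; split=> [|x y|y yd]; [exact: refl_linear|exact: refl_form|].
rewrite /lor_refl addrAC subrr sub0r -scaleNr; apply: intUZ => //.
by rewrite rpredN; apply: lform_int.
Qed.

Inductive lor_simple : U -> Prop :=
| SimpleM1 : lor_simple (mkU 0 1 (-1))
| Simple0 : lor_simple (mkU (- theta0) (-1) 0)
| SimpleS i : lor_simple (mkU (alpha i) 0 0).

Definition lor_act (s : seq U) x : U := foldr lor_refl x s.

Definition words (P : U -> Prop) (s : seq U) := {in s, forall X, P X}.

Lemma words_cat P s r : words P s -> words P r -> words P (s ++ r).
Proof. by move=> sP rP X; rewrite mem_cat => /orP[/sP|/rP]. Qed.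

Lemma words_rev P s : words P s -> words P (rev s).
Proof. by move=> sP X; rewrite mem_rev => /sP. Qed.

Lemma words_cons P X s : P X -> words P s -> words P (X :: s).
Proof. by move=> XP sP Y; rewrite inE => /orP[/eqP->|/sP]. Qed.

Lemma act_cat s r x : lor_act (s ++ r) x = lor_act s (lor_act r x).
Proof. by rewrite /lor_act foldr_cat. Qed.

Lemma marks_norm : kappa theta0 theta0 = 2.
Proof.
case: n Htn => [|m] Hm; first by case: (t) Hm.
have [|+ _] := @marks_orbit t m.+1 Hm (fun p => Defs.kappa t p p = 2) _ ord0.
  move=> i v v2; rewrite kappaBl !kappaBr !kappaZl !kappaZr kappa_simple2.
  by rewrite cartan_diag v2 (kappaC t _ v); ring.
by apply; rewrite kappa_simple2 cartan_diag.
Qed.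

Lemma marks_int : intv theta0.
Proof. by move=> i; rewrite mxE intr_int. Qed.

Lemma kappa0l v : kappa 0 v = 0.
Proof. by rewrite -(scale0r 0) kappaZl mul0r. Qed.
Lemma kappa0r v : kappa v 0 = 0.
Proof. by rewrite kappaC kappa0l. Qed.
Lemma kappaNl u v : kappa (- u) v = - kappa u v.
Proof. by rewrite -scaleN1r kappaZl mulN1r. Qed.
Lemma kappaNr u v : kappa u (- v) = - kappa u v.
Proof. by rewrite kappaC kappaNl kappaC. Qed.

Lemma simpleU_norm X : lor_simple X -> K X X = 2.
Proof.
case=> [||i]; rewrite /K !UE ?kappa0l ?kappaNl ?kappaNr ?marks_norm.
- by ring.
- by ring.
- by rewrite kappa_simple2 cartan_diag; ring.
Qed.

Lemma intU_mk v a b : intv v -> a \is a Num.int -> b \is a Num.int -> intU (mkU v a b).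
Proof. by move=> *; split; rewrite ?mkUE. Qed.

Lemma intv0 : intv (0 : V).
Proof. by move=> i; rewrite mxE rpred0. Qed.
Lemma intvN v : intv v -> intv (- v).
Proof. by move=> vi i; rewrite mxE rpredN. Qed.

Lemma simpleU_int X : lor_simple X -> intU X.
Proof.
case=> [||i]; apply: intU_mk; rewrite ?rpredN ?rpred1 ?rpred0 //.
- exact: intv0.
- exact/intvN/marks_int.
- exact: simple_root_int.
Qed.

Lemma act_rev P s : (forall X, P X -> K X X = 2) -> words P s ->
  cancel (lor_act s) (lor_act (rev s)).
Proof.
move=> P2; elim: s => [|X s IHs] sP x //=.
rewrite rev_cons -cats1 act_cat /= reflK.
  by apply: IHs => Y Ys; apply: sP; rewrite inE Ys orbT.
by apply/P2/sP; rewrite mem_head.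
Qed.

Lemma act_iso s : words lor_simple s -> lor_iso (lor_act s).
Proof.
elim: s => [|X s IHs] sP.
  split=> //= y _; rewrite subrr -(scale0r 0); apply: intUZ => //.
  by split; rewrite ?UE //; first exact: intv0; rewrite /lc1 /lc2 mxE rpred0.
have XP : lor_simple X by apply: sP; rewrite mem_head.
apply: (@lat_iso_comp (lor_refl X) (lor_act s)).
  by apply: refl_iso; [exact: simpleU_norm|exact: simpleU_int].
by apply: IHs => Y Ys; apply: sP; rewrite inE Ys orbT.
Qed.

(* Reflecting in roots that pair negatively with [x] increases [K r x], which
   stays bounded. *)
Lemma descent (P Inv : U -> Prop) (r : U) (b : rat) :
  (forall X, P X -> K X X = 2) -> (forall X, P X -> 1 <= K r X) ->
  (forall x X, Inv x -> P X -> Inv (lor_refl X x)) ->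
  (forall x X, Inv x -> P X -> K x X \is a Num.int) ->
  (forall x, Inv x -> K r x <= b) ->
  forall x, Inv x -> exists s, [/\ words P s, Inv (lor_act s x)
    & forall X, P X -> 0 <= K (lor_act s x) X].
Proof.
move=> P2 Pr Ir Ii Ib.
have step x : Inv x -> (forall X, P X -> 0 <= K x X) \/
    exists2 X, P X & K r x + 1 <= K r (lor_refl X x).
  move=> xI; case: (pselect (exists2 X, P X & K x X < 0)) => [[X XP Xx]|h]; last first.
    by left=> X XP; rewrite leNgt; apply/negP => Xx; apply: h; exists X.
  right; exists X => //; have Xx1 : K x X <= -1.
    have := norm_intr_ge1 (Ii _ _ xI XP) (ltr0_neq0 Xx).
    by rewrite ltr0_norm // lerNr.
  rewrite /lor_refl !lformE; move: (Pr _ XP) Xx1; move: (K r X) (K x X) (K r x).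
  by move=> p q s; nra.
suff H (N : nat) x : Inv x -> b - K r x <= N%:R -> exists s,
    [/\ words P s, Inv (lor_act s x) & forall X, P X -> 0 <= K (lor_act s x) X].
  move=> x xI; apply: (H (Num.bound (b - K r x)) x xI).
  by apply/ltW/archi_boundP; rewrite subr_ge0 Ib.
elim: N x => [|N IHN] x xI xN; (case: (step x xI) => [h|[X XP rx]]; first by exists [::]).
  by have := Ib _ (Ir _ _ xI XP); move: xN; lra.
have [||s [sP sI s0]] := IHN (lor_refl X x); first exact: Ir.
  by move: xN; rewrite -natr1; lra.
exists (s ++ [:: X]); rewrite act_cat; split=> //.
by apply: words_cat => //; apply: words_cons.
Qed.

End LorentzLattice.

(** * The forward light cone and its dominant vectors *)

Section LorentzCone.
Variables (t : ade) (n : nat).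
Hypothesis Htn : listed_type t n.
Local Notation V := 'rV[rat]_n.
Local Notation U := (vahlen_space V).
Local Notation alpha := (@simple_root n).
Local Notation C := (cartan t n).
Local Notation kappa := (@Defs.kappa t n).
Local Notation G := (weight_gram t n).
Local Notation theta0 := (marks t n).
Local Notation rho := (weyl_vec t n).
Local Notation K := (@lform t n).
Local Notation refl := (@lor_refl t n).
Local Notation act := (@lor_act t n).
Local Notation simpleU := (@lor_simple t n).
Local Notation lat_iso := (@lor_iso t n).
Implicit Types (x y z X Y : U) (v q : V) (w g : U -> U).

Let GC : G *m C = 1%:M := weight_gram_cartan Htn.

Definition hyp1 : U := mkU 0 1 0.
Definition hyp2 : U := mkU 0 0 1.

Lemma lform_f1 x : K x hyp1 = - lc2 x.
Proof. by rewrite /lform !UE kappa0r; ring. Qed.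
Lemma lform_f2 x : K x hyp2 = - lc1 x.
Proof. by rewrite /lform !UE kappa0r; ring. Qed.
Lemma lform_M1 x : K x (mkU 0 1 (-1)) = lc1 x - lc2 x.
Proof. by rewrite /lform !UE kappa0r; ring. Qed.
Lemma lform_0 x : K x (mkU (- theta0) (-1) 0) = lc2 x - kappa x.1 theta0.
Proof. by rewrite /lform !UE kappaNr; ring. Qed.
Lemma lform_S x v : K x (mkU v 0 0) = kappa x.1 v.
Proof. by rewrite /lform !UE; ring. Qed.

Lemma int_gt0_ge1 (a : rat) : a \is a Num.int -> 0 < a -> 1 <= a.
Proof. by move=> ai a0; have := norm_intr_ge1 ai (lt0r_neq0 a0); rewrite gtr0_norm. Qed.

Lemma int_mul_eq1 (a b : rat) : a \is a Num.int -> b \is a Num.int ->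
  0 <= a -> a * b = 1 -> a = 1.
Proof.
move=> ai bi a0 ab; have ap : 0 < a.
  by rewrite lt_neqAle a0 andbT; apply/eqP => a0'; move: ab; rewrite -a0' mul0r => /eqP; rewrite eq_sym oner_eq0.
have bp : 0 < b by rewrite -(pmulr_rgt0 _ ap) ab.
by have := int_gt0_ge1 ai ap; have := int_gt0_ge1 bi bp; nra.
Qed.

Lemma kappa_marks v : kappa v theta0 = \sum_i kappa v (alpha i) * theta0 0 i.
Proof. exact: kappa_coord. Qed.

(* With [m] the marks of the highest root, the fundamental weights satisfy
   [kappa w_i w_j <= 2 m_i m_j].  Equality, which would allow another isotropic
   vector, occurs only for the two half-spin weights of D_8, and these are not
   in the root lattice. *)
Lemma dominant_isotropic x y : intU x -> intU y -> K x x = 0 -> K x y = 1 ->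
  0 <= lc1 x -> 0 <= lc2 x -> (forall X, simpleU X -> 0 <= K x X) -> x = hyp1.
Proof.
move=> [vi ai bi] [yi y1 y2] xx xy a0 b0 dom.
have := dom _ (SimpleM1 t n); rewrite lform_M1 => ba.
have := dom _ (Simple0 t n); rewrite lform_0 => bt.
have c0 i : 0 <= kappa x.1 (alpha i) by rewrite -lform_S; apply/dom/SimpleS.
pose v := x.1; pose c i := kappa v (alpha i).
have vG : v = \sum_i c i *: weight G i.
  have {1}-> : v = v *m C *m G by rewrite -mulmxA cartan_weight_gram // mulmx1.
  by rewrite mulmx_sum_row; apply: eq_bigr => i _; rewrite /c kappa_simple.
have nv : kappa v v = 2 * (lc1 x * lc2 x).
  by move: xx; rewrite /lform -/v => xx; lra.
have m0 i : 0 < theta0 0 i by apply: marks_gt0.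
(* Dominance reads [lc1 x >= lc2 x >= kappa v theta0], so [kappa v v = 2 * (lc1 x * lc2 x)] is at
   least [2 * kappa v theta0 ^+ 2]. The nonnegative terms [d i j] sum to the difference in the
   opposite direction, so for [lc2 x > 0] all these inequalities are equalities. *)
pose d i j := c i * c j * (2 * theta0 0 i * theta0 0 j - G i j).
have d0 i j : 0 <= d i j.
  by rewrite mulr_ge0 ?mulr_ge0 ?c0 // subr_ge0; case: (weight_gram_check Htn i j).
have sd : \sum_i \sum_j d i j = 2 * kappa v theta0 ^+ 2 - kappa v v.
  rewrite (kappa_weights Htn) kappa_marks expr2 mulr_suml mulr_sumr -sumrB.
  apply: eq_bigr => i _; rewrite mulr_sumr mulr_sumr -sumrB; apply: eq_bigr => j _.
  by rewrite /d /c; ring.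
have t0 : 0 <= kappa v theta0.
  by rewrite kappa_marks sumr_ge0 // => i _; rewrite mulr_ge0 ?c0 ?ltW.
have sd0 : 0 <= \sum_i \sum_j d i j by do 2!(apply: sumr_ge0 => ? _).
rewrite -/v in bt.
have [b0'|bp] : lc2 x = 0 \/ 0 < lc2 x.
  by move: b0; rewrite le_eqVlt => /orP[/eqP|]; [left|right].
  have v0 : v = 0 by apply: (kappa_eq0 Htn); rewrite nv b0' mulr0 mulr0.
  apply: U_ext; rewrite ?UE //.
  apply: (@int_mul_eq1 _ (- lc2 y)); rewrite ?rpredN //.
  by rewrite -xy /lform -/v v0 kappa0l b0'; ring.
exfalso.
have sd1 : \sum_i \sum_j d i j = 0 by move: sd0; rewrite sd nv; nra.
have ab : lc1 x = lc2 x by move: sd0; rewrite sd nv; nra.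
have tb : kappa v theta0 = lc2 x by move: sd1; rewrite sd nv ab; nra.
have dz i j : d i j = 0.
  move/eqP: sd1; rewrite psumr_eq0 => [|k _]; last by apply: sumr_ge0.
  move=> /allP/(_ i (mem_index_enum _)); rewrite psumr_eq0 // => /allP.
  by move=> /(_ j (mem_index_enum _))/eqP.
have [k ck] : exists k, c k != 0.
  apply: contrapT => h; move: bp; rewrite -tb kappa_marks big1 ?ltxx // => i _.
  suff -> : kappa v (alpha i) = 0 by rewrite mul0r.
  by apply/eqP; apply: contrapT => /negP e; apply: h; exists i.
have tight i j : c i != 0 -> c j != 0 -> i = j /\ ~ intv (row i G).
  move=> ci cj; have [_ _ h] := weight_gram_check Htn i j; apply: h.
  apply/eqP; rewrite eq_sym -subr_eq0; move/eqP: (dz i j).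
  by rewrite /d !mulf_eq0 (negbTE ci) (negbTE cj).
have cz i : i != k -> c i = 0.
  move=> ik; apply/eqP; apply: contrapT => /negP ci.
  by have [/eqP] := tight _ _ ci ck; rewrite (negbTE ik).
have vE : v = c k *: weight G k.
  by rewrite {1}vG (bigD1 k) //= big1 ?addr0 // => i /cz ->; rewrite scale0r.
have tE : lc2 x = c k * theta0 0 k.
  by rewrite -tb kappa_marks (bigD1 k) //= big1 ?addr0 // => i /cz; rewrite /c => ->; rewrite mul0r.
(* Now [x] is [c k] times a vector that pairs integrally with [y], and [K x y = 1] forces [c k = 1].
   Weight [k] would then be [v], a vector of the root lattice. *)
have c1 : c k = 1.
  apply: (@int_mul_eq1 _ (y.1 0 k - theta0 0 k * (lc1 y + lc2 y))).
  - by apply: kappa_int; [apply: intv_dual|apply: simple_root_int].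
  - by rewrite rpredB // rpredM ?rpredD //; apply: marks_int.
  - exact: c0.
  by rewrite -xy /lform -/v {1}vE kappaZl (kappa_weight GC) ab tE; ring.
have [_ h] := tight _ _ ck ck; apply: h.
by rewrite -[row k G]scale1r -c1 -vE.
Qed.

Definition in_cone x := [/\ intU x, K x x = 0, 0 <= lc1 x & 0 <= lc2 x].

(** The reflection in X_{-1} exchanges [lc1] and [lc2], and those in the finite roots fix both. The
    one in X_0 keeps [lc2], and the sign of [lc1] follows from [2 lc1 lc2 = kappa v v >= 0], or from
    [v = 0] when [lc2] vanishes. *)
Lemma cone_refl x X : in_cone x -> simpleU X -> in_cone (refl X x).
Proof.
move=> [xi xx a0 b0] XS; have X2 := simpleU_norm Htn XS.
have rI : lat_iso (refl X) by apply: refl_iso => //; apply: simpleU_int XS.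
split; first exact: lat_iso_int rI xi.
- by rewrite refl_form.
- case: XS X2 rI => [||i] X2 rI.
  + by rewrite /lor_refl lform_M1 !UE; lra.
  + have : K (refl (mkU (- theta0) (-1) 0) x) (refl (mkU (- theta0) (-1) 0) x) = 0.
      by rewrite refl_form.
    rewrite {1}/lform; set x' := refl _ x => xx'.
    have l2 : lc2 x' = lc2 x by rewrite /x' /lor_refl lform_0 !UE; ring.
    have k0 := kappa_ge0 Htn x'.1.
    move: b0; rewrite le_eqVlt => /orP[/eqP b0|b0]; last by move: xx'; rewrite l2; nra.
    have v0 : x.1 = 0.
      by apply: (kappa_eq0 Htn); move: xx; rewrite /lform -b0; lra.
    by rewrite /x' /lor_refl lform_0 !UE v0 kappa0l -b0; lra.
  + by rewrite /lor_refl !UE; lra.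
- case: XS X2 rI => [||i] X2 rI; rewrite /lor_refl ?lform_M1 !UE; lra.
Qed.

Lemma cone_descent x : in_cone x -> exists s,
  [/\ words simpleU s, in_cone (act s x) & forall X, simpleU X -> 0 <= K (act s x) X].
Proof.
(* The choice of [b] makes [mkU rho B b] pair to 1 with X_0. The choice of [B] gives at least 1 with
   X_{-1} and makes the vector timelike, so that its pairing with the cone is at most 0. *)
pose b := kappa rho theta0 + 1; pose B := kappa rho rho + b + 1.
have b1 : 1 <= b.
  rewrite lerDr (kappa_rho Htn) sumr_ge0 // => i _; exact/ltW/marks_gt0.
have r0 := kappa_ge0 Htn rho.
apply: (@descent t n simpleU in_cone (mkU rho B b) 0).
- exact: simpleU_norm.
- move=> X [||i]; rewrite ?lform_M1 ?lform_0 ?lform_S !UE; [rewrite /B; lra|rewrite /b; lra|].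
  by rewrite kappa_rho_simple.
- exact: cone_refl.
- move=> y X [yi _ _ _] XS; apply: lform_int; first exact: intU_dual.
  exact: simpleU_int XS.
move=> y [yi yy a0 b0]; rewrite {1}/lform !UE.
have yv : kappa y.1 y.1 = 2 * (lc1 y * lc2 y) by move: yy; rewrite /lform; lra.
move: b0; rewrite le_eqVlt => /orP[/eqP b0|b0].
  have -> : y.1 = 0 by apply: (kappa_eq0 Htn); rewrite yv -b0; ring.
  rewrite kappa0r -b0; nra.
(* Reverse Cauchy-Schwarz: the coefficients are chosen so that a positive factor [2 * b * lc2 y]
   splits off and leaves the bound. *)
have := kappa_ge0 Htn (b *: y.1 - lc2 y *: rho).
rewrite kappaBl !kappaBr !kappaZl !kappaZr (kappaC t y.1 rho) yv => h.
have BR : kappa rho rho <= 2 * B * b by rewrite /B; nra.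
have {}h : 0 <= (2 * b * lc2 y) * (b * lc1 y + B * lc2 y - kappa rho y.1).
  have : 0 <= lc2 y ^+ 2 * (2 * B * b - kappa rho rho) by rewrite mulr_ge0 ?sqr_ge0 ?subr_ge0.
  by move: h; nra.
have p0 : 0 < 2 * b * lc2 y by rewrite !mulr_gt0 //; lra.
by move: h; rewrite pmulr_rge0 //; lra.
Qed.

End LorentzCone.

(** * Affine reflections and Eichler transvections in the Weyl group *)

Section LorentzWeyl.
Variables (t : ade) (n : nat).
Hypothesis Htn : listed_type t n.
Local Notation V := 'rV[rat]_n.
Local Notation U := (vahlen_space V).
Local Notation alpha := (@simple_root n).
Local Notation C := (cartan t n).
Local Notation kappa := (@Defs.kappa t n).
Local Notation G := (weight_gram t n).
Local Notation theta0 := (marks t n).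
Local Notation K := (@lform t n).
Local Notation refl := (@lor_refl t n).
Local Notation act := (@lor_act t n).
Local Notation simpleU := (@lor_simple t n).
Implicit Types (x y z X Y : U) (v q : V) (w g : U -> U).

Definition in_weyl w := exists2 s, words simpleU s & w =1 act s.

Lemma in_weyl_comp w1 w2 : in_weyl w1 -> in_weyl w2 -> in_weyl (w1 \o w2).
Proof.
move=> [s sS es] [r rS er]; exists (s ++ r); first exact: words_cat.
by move=> x /=; rewrite act_cat er es.
Qed.

Lemma in_weyl_eq w1 w2 : w1 =1 w2 -> in_weyl w1 -> in_weyl w2.
Proof. by move=> e [s sS es]; exists s => // x; rewrite -e es. Qed.

Lemma in_weyl_inv w1 w2 : cancel w2 w1 -> in_weyl w1 -> in_weyl w2.
Proof.
move=> wK [s sS es]; exists (rev s); first exact: words_rev.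
move=> x; rewrite -{2}(wK x) es.
by rewrite (act_rev (simpleU_norm Htn) sS).
Qed.

Lemma in_weyl_simple X : simpleU X -> in_weyl (refl X).
Proof. by move=> XS; exists [:: X] => // Y; rewrite inE => /eqP->. Qed.

Lemma refl_conj X Y x : K Y Y = 2 ->
  refl (refl Y X) x = refl Y (refl X (refl Y x)).
Proof.
move=> Y2; rewrite -{1}[x](reflK Y2); set z := refl Y x.
have -> : refl X z = (- K z X) *: X + z by rewrite /lor_refl addrC scaleNr.
by rewrite (refl_linear t Y) {1}/lor_refl refl_form // addrC scaleNr.
Qed.

Lemma reflN X : refl (- X) =1 refl X.
Proof. by move=> x; rewrite /lor_refl !lformE scalerN scaleNr opprK. Qed.

Lemma in_weyl_refl X Y : simpleU Y -> in_weyl (refl X) -> in_weyl (refl (refl Y X)).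
Proof.
move=> YS wX; have Y2 := simpleU_norm Htn YS.
apply: (in_weyl_eq (fun x => esym (refl_conj X x Y2))).
apply: (in_weyl_comp (in_weyl_simple YS)); apply: in_weyl_comp wX _.
exact: in_weyl_simple.
Qed.

(** For the highest root this is the reflection in [- X_0]. Finite reflections fix f1, so
    conjugating by them moves only the finite part, and [marks_orbit] reaches each simple root. *)
Lemma in_weyl_affine i : in_weyl (refl (mkU (alpha i) 1 0)).
Proof.
have [|_] := marks_orbit Htn (P := fun v => in_weyl (refl (mkU v 1 0))) _ i.
  move=> j v vw; have := in_weyl_refl (SimpleS t j) vw.
  congr (in_weyl (refl _)); rewrite /lor_refl lform_S.
  by apply: U_ext; rewrite !UE //; ring.
apply; apply: (in_weyl_eq (@reflN _)).
have -> : - mkU theta0 1 0 = mkU (- theta0) (-1) 0.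
  by apply: U_ext; rewrite !UE ?oppr0.
exact/in_weyl_simple/Simple0.
Qed.

(* The Eichler transvection along the isotropic vector [f1] *)
Definition trans q x : U :=
  mkU (x.1 + lc2 x *: q) (lc1 x + kappa x.1 q + kappa q q / 2 * lc2 x) (lc2 x).

Lemma trans_comp p q : trans p \o trans q =1 trans (p + q).
Proof.
move=> x; apply: U_ext; rewrite /trans /= !UE //.
  by rewrite scalerDr -addrA [lc2 x *: q + _]addrC.
by rewrite !kappaDl !kappaDr !kappaZl (kappaC t q p); field.
Qed.

Lemma trans0 : trans 0 =1 id.
Proof.
move=> x; apply: U_ext; rewrite /trans !UE ?scaler0 ?addr0 //.
by rewrite !kappa0r; ring.
Qed.

Lemma trans_simple i : in_weyl (trans (alpha i)).
Proof.
apply: in_weyl_eq (in_weyl_comp (in_weyl_affine i) (in_weyl_simple (SimpleS t i))).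
move=> x; rewrite /lor_refl /= !lform_S.
have e : K (x - kappa x.1 (alpha i) *: mkU (alpha i) 0 0) (mkU (alpha i) 1 0) = - kappa x.1 (alpha i) - lc2 x.
  by rewrite /lform !UE kappaDl kappaNl kappaZl kappa_simple2 cartan_diag; ring.
rewrite e; apply: U_ext; rewrite /trans !UE.
- rewrite -addrA -opprD -scalerDl -scaleNr; congr (_ + _ *: _); ring.
- by rewrite kappa_simple2 cartan_diag; field.
- by ring.
Qed.

Lemma transN q : cancel (trans (- q)) (trans q).
Proof. by move=> x; have := trans_comp q (- q) x; rewrite /= subrr trans0. Qed.

Lemma trans_weyl q : intv q -> in_weyl (trans q).
Proof.
move=> qi; rewrite (row_sum_simple q); elim/big_ind: _ => [|p r pw rw|i _].
- by exists [::] => // x; rewrite trans0.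
- exact: in_weyl_eq (trans_comp p r) (in_weyl_comp pw rw).
have nat_mul k : in_weyl (trans (k%:R *: alpha i)).
  elim: k => [|k IHk]; first by rewrite scale0r; exists [::] => // x; rewrite trans0.
  rewrite -natr1 scalerDl scale1r.
  exact: in_weyl_eq (trans_comp _ _) (in_weyl_comp IHk (trans_simple i)).
case/intrP: (qi i) => -[k|k] ->; first exact: nat_mul.
rewrite NegzE mulrNz scaleNr.
exact: in_weyl_inv (@transN _) (nat_mul k.+1).
Qed.

End LorentzWeyl.

(** * Isometries acting trivially on the discriminant group *)

Section LorentzClassification.
Variables (t : ade) (n : nat).
Hypothesis Htn : listed_type t n.
Local Notation V := 'rV[rat]_n.
Local Notation U := (vahlen_space V).
Local Notation alpha := (@simple_root n).
Local Notation C := (cartan t n).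
Local Notation kappa := (@Defs.kappa t n).
Local Notation G := (weight_gram t n).
Local Notation rho := (weyl_vec t n).
Local Notation K := (@lform t n).
Local Notation refl := (@lor_refl t n).
Local Notation act := (@lor_act t n).
Local Notation simpleU := (@lor_simple t n).
Local Notation dualU := (@lor_dual t n).
Local Notation lat_iso := (@lor_iso t n).
Implicit Types (x y z X Y : U) (v q : V) (w g : U -> U).

Let GC : G *m C = 1%:M := weight_gram_cartan Htn.
Local Notation f1 := (@hyp1 n).
Local Notation f2 := (@hyp2 n).

Lemma lat_isoZ g a x : lat_iso g -> g (a *: x) = a *: g x.
Proof.
case=> gl _ _; have g0 : g 0 = 0.
  have := gl (-1) 0 0; rewrite scaler0 addr0 scaleN1r => e.
  by rewrite e addNr.
by have := gl a x 0; rewrite g0 !addr0.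
Qed.

Lemma lat_isoD g x y : lat_iso g -> g (x + y) = g x + g y.
Proof. by case=> gl _ _; have := gl 1 x y; rewrite !scale1r. Qed.

Section FixPlane.
Variables (e : rat) (h : U -> U).
Hypotheses (ee : e * e = 1) (hI : lat_iso h).
Hypotheses (h1 : h f1 = e *: f1) (h2 : h f2 = e *: f2).

Let e_neq0 : e != 0.
Proof. by apply/eqP => e0; move: ee; rewrite e0 mul0r => /eqP; rewrite eq_sym oner_eq0. Qed.

Lemma fix_plane_mk v : h (mkU v 0 0) = mkU (h (mkU v 0 0)).1 0 0.
Proof.
have [_ hK _] := hI.
apply: U_ext; rewrite ?mkUE //; apply: (mulfI e_neq0); rewrite mulr0; apply: oppr_inj.
  by have := hK (mkU v 0 0) f2; rewrite h2 lformZr !lform_f2 mkUE mulrN => ->.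
by have := hK (mkU v 0 0) f1; rewrite h1 lformZr !lform_f1 mkUE mulrN => ->.
Qed.

Definition fin_part v : V := (h (mkU v 0 0)).1.

Lemma fin_part_kappa u v : kappa (fin_part u) (fin_part v) = kappa u v.
Proof.
have [_ hK _] := hI.
by rewrite -[RHS](lform_S _ (mkU u 0 0)) -hK (fix_plane_mk u) (fix_plane_mk v) lform_S.
Qed.

Lemma fin_part_disc v : dualv t v -> intv (fin_part v - v).
Proof.
move=> vd; have [_ _ /(_ (mkU v 0 0))] := hI; case=> //.
by split; rewrite ?mkUE.
Qed.

Lemma fin_part_dual v : dualv t v -> dualv t (fin_part v).
Proof.
move=> vd; have := @lat_iso_dual t n h (mkU v 0 0) hI; case=> //.
by split; rewrite ?mkUE.
Qed.

Lemma fin_part_int v : intv v -> intv (fin_part v).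
Proof.
by move=> vi; have [] := @lat_iso_int t n h (mkU v 0 0) hI (intU_mk vi (rpred0 _) (rpred0 _)).
Qed.

Lemma plane_inv g : cancel h g -> lat_iso g -> g f1 = e *: f1 /\ g f2 = e *: f2.
Proof.
move=> hgK gI.
have inv f : h f = e *: f -> g f = e *: f.
  by move=> hf; rewrite -{2}(hgK f) hf lat_isoZ // scalerA ee scale1r.
by split; apply: inv.
Qed.

Lemma fix_simple : (forall i, fin_part (alpha i) = alpha i) ->
  forall x, h x = mkU x.1 (e * lc1 x) (e * lc2 x).
Proof.
move=> ha x.
have hv v : h (mkU v 0 0) = mkU v 0 0.
  rewrite (row_sum_simple v).
  have mkS : mkU (\sum_i v 0 i *: alpha i) 0 0 = \sum_i v 0 i *: mkU (alpha i) 0 0.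
    elim/big_rec2: _ => [|i y1 y2 _ <-]; apply: U_ext; rewrite !UE ?mulr0 ?addr0 //.
      by rewrite /lc1 mxE.
    by rewrite /lc2 mxE.
  rewrite mkS; have h0 : h 0 = 0 by rewrite -(scale0r 0) lat_isoZ // !scale0r.
  apply: (big_ind (fun y => h y = y)) => // [y1 y2 e1 e2|i _].
    by rewrite (lat_isoD _ _ hI) e1 e2.
  by rewrite (lat_isoZ _ _ hI) fix_plane_mk -/(fin_part _) ha.
have {1}-> : x = mkU x.1 0 0 + (lc1 x *: f1 + lc2 x *: f2).
  by apply: U_ext; rewrite !UE ?scaler0 ?addr0 //; ring.
rewrite !(lat_isoD _ _ hI) !(lat_isoZ _ _ hI) hv h1 h2.
by apply: U_ext; rewrite !UE ?scaler0 ?addr0 //; ring.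
Qed.

End FixPlane.

(** The inverse [h'] is needed because the image of rho pairs with a simple root as rho pairs with
    the preimage of that root, an integral vector of norm 2. This pairing is a nonzero integer, so
    dominance makes it at least 1, and [rho_unique] shows that [h] fixes rho. *)
Lemma finite_rigid e h h' : e * e = 1 -> lat_iso h -> lat_iso h' -> cancel h' h ->
  h f1 = e *: f1 -> h f2 = e *: f2 -> h' f1 = e *: f1 -> h' f2 = e *: f2 ->
  (forall i, 0 <= kappa (fin_part h rho) (alpha i)) ->
  forall i, fin_part h (alpha i) = alpha i.
Proof.
move=> ee hI h'I h'K h1 h2 h'1 h'2 dom.
have hk := fin_part_kappa ee hI h1 h2.
have h'k := fin_part_kappa ee h'I h'1 h'2.
have finK v : fin_part h (fin_part h' v) = v.
  by rewrite {1}/fin_part -(fix_plane_mk ee h'I) // h'K.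
have rd := rho_dual Htn.
have hr : fin_part h rho = rho.
  apply: (rho_unique Htn); [exact: fin_part_dual|exact: hk|move=> i].
  have mi : kappa (fin_part h rho) (alpha i) \is a Num.int.
    by move: (fin_part_dual hI rd) => /dualvP.
  apply: int_gt0_ge1 => //; rewrite lt_neqAle dom andbT eq_sym; apply/eqP.
  rewrite -[alpha i]finK hk.
  apply: (norm2_height0 Htn); first exact/fin_part_int/simple_root_int.
  by rewrite h'k kappa_simple2 cartan_diag.
have perm i : exists j, fin_part h (alpha i) = alpha j.
  apply: (norm2_height1 Htn); first exact/fin_part_int/simple_root_int.
    by rewrite hk kappa_simple2 cartan_diag.
  by rewrite -hr hk kappa_rho_simple.
have [s hs] := choice perm.
suff sid : forall i, s i = i by move=> i; rewrite hs sid.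
have sC i j : C (s i) (s j) = C i j.
  by rewrite -!kappa_simple2 -!hs hk kappa_simple2.
have sI : injective s.
  move=> i j eij; apply/eqP; apply: contrapT => /negP ij.
  have := cartan_off t ij; rewrite -sC eij cartan_diag.
  by rewrite -subr_ge0 sub0r oppr_ge0 lern0.
(* The weights are permuted in the same way as the simple roots, so triviality on the discriminant
   group compares weight [s i] with weight [i]. *)
apply: (diagram_rigid Htn sC) => i j.
have /(_ j) := fin_part_disc hI (weight_dual GC i).
suff -> : fin_part h (weight G i) = weight G (s i) by rewrite !mxE.
have wE v : v = v *m C *m G by rewrite -mulmxA cartan_weight_gram // mulmx1.
rewrite [LHS]wE [RHS]wE; congr (_ *m _); apply/rowP => k.
rewrite -!kappa_simple; have [s' _ s'K] := injF_bij sI.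
rewrite -(s'K k) -hs hk hs !(kappa_weight GC) !mxE !eqxx /= (inj_eq sI).
by [].
Qed.

(** The descent restricted to finite simple roots, which are orthogonal to f1 and f2. As [v] and rho
    have equal norms, [kappa (rho - v) (rho - v) >= 0] supplies the bound. *)
Lemma fin_descent v : dualv t v -> kappa v v = kappa rho rho -> exists s,
  [/\ words simpleU s, act s f1 = f1, act s f2 = f2 &
      forall i, 0 <= kappa (act s (mkU v 0 0)).1 (alpha i)].
Proof.
pose P X := exists i, X = mkU (alpha i) 0 0.
pose Inv x := [/\ dualU x, x = mkU x.1 0 0 & kappa x.1 x.1 = kappa rho rho].
have PS X : P X -> simpleU X by case=> i ->; apply: SimpleS.
move=> vd vv; have vI : Inv (mkU v 0 0) by split=> //; split; rewrite ?mkUE.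
have [|||||s [sP _ s0]] := @descent t n P Inv (mkU rho 0 0) (kappa rho rho) _ _ _ _ _ _ vI.
- by move=> X /PS/(simpleU_norm Htn).
- by move=> X [i ->]; rewrite lform_S mkUE (kappa_rho_simple Htn).
- move=> x X [xd xe xx] PX; have XS := PS _ PX; have X2 := simpleU_norm Htn XS.
  have rI : lat_iso (refl X) by apply: refl_iso => //; apply: simpleU_int XS.
  have e : refl X x = mkU (refl X x).1 0 0.
    case: PX => i ->; apply: U_ext; rewrite ?mkUE // /lor_refl xe !UE; ring.
  split=> //; first exact: lat_iso_dual xd.
  rewrite -[LHS](lform_S _ (mkU (refl X x).1 0 0)) -e refl_form //.
  by rewrite xe lform_S.
- by move=> x X [xd _ _] /PS XS; apply: lform_int => //; apply: simpleU_int XS.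
- move=> x [_ -> xx]; rewrite lform_S !mkUE.
  have := kappa_ge0 Htn (rho - x.1); rewrite kappaBl !kappaBr (kappaC t x.1 rho) xx.
  by lra.
have fixf f : (forall i, K f (mkU (alpha i) 0 0) = 0) -> act s f = f.
  move=> f0; elim: s sP {s0} => [//|X s IHs] sP /=.
  rewrite IHs => [|Y Ys]; last by apply: sP; rewrite inE Ys orbT.
  by have [i ->] := sP X (mem_head _ _); rewrite /lor_refl f0 scale0r subr0.
exists s; split.
- by move=> X /sP/PS.
- by apply: fixf => i; rewrite lform_S mkUE kappa0l.
- by apply: fixf => i; rewrite lform_S mkUE kappa0l.
- by move=> i; rewrite -lform_S; apply: s0; exists i.
Qed.

(** The second alternative is unavoidable at this level: -1 on the hyperbolic plane is trivial on
    the discriminant group, but it exchanges the two halves of the light cone, which Weyl group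
    elements preserve. *)
Theorem lattice_weyl g g' : lat_iso g -> lat_iso g' -> cancel g g' -> cancel g' g ->
  exists2 s, words simpleU s &
    (forall x, act s (g x) = x) \/
    (forall x, act s (g x) = mkU x.1 (- lc1 x) (- lc2 x)).
Proof.
move=> gI g'I gK g'K.
have [e ee [s1 s1S s1f]] : exists2 e : rat, e = 1 \/ e = -1 &
    exists2 s, words simpleU s & act s (g f1) = e *: f1.
  have f1i : intU f1 by apply: intU_mk; rewrite ?rpred0 ?rpred1 //; apply: intv0.
  have f2i : intU f2 by apply: intU_mk; rewrite ?rpred0 ?rpred1 //; apply: intv0.
  pose x := g f1; have xi : intU x := lat_iso_int gI f1i.
  have [_ gform _] := gI.
  have xx : K x x = 0 by rewrite gform lform_f1 mkUE oppr0.
  have x12 : 0 <= lc1 x * lc2 x.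
    by have := kappa_ge0 Htn x.1; move: xx; rewrite /lform; lra.
  have [e ee [ex1 ex2]] : exists2 e : rat, e = 1 \/ e = -1 & 0 <= e * lc1 x /\ 0 <= e * lc2 x.
    have [p1|n1] := leP 0 (lc1 x); have [p2|n2] := leP 0 (lc2 x).
    - by exists 1; [left|rewrite !mul1r].
    - by exists (-1); [right|split; nra].
    - by exists (-1); [right|split; nra].
    - by exists (-1); [right|split; nra].
  have eei : e \is a Num.int by case: ee => ->; rewrite ?rpredN rpred1.
  have e2 : e * e = 1 by case: ee => ->; ring.
  have exC : in_cone t (e *: x).
    split; rewrite ?UE //; first exact: intUZ.
    by rewrite lformZl lformZr xx !mulr0.
  have [s [sS [yi yy y1 y2] sd]] := cone_descent Htn exC.
  have sI : lat_iso (act s) := act_iso Htn sS.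
  have [_ sform _] := sI.
  exists e => //; exists s => //.
  suff : act s (e *: x) = f1.
    move/(congr1 (fun z => e *: z)).
    by rewrite (lat_isoZ _ _ sI) scalerA e2 scale1r.
  (* Since [K f1 f2 = -1], it is the image of [- f2] that pairs to 1 with the image of [f1]. *)
  apply: (@dominant_isotropic t n Htn _ (act s (e *: g (- f2)))) => //.
  - apply: (lat_iso_int sI); apply: intUZ => //; apply: (lat_iso_int gI).
    by rewrite -scaleN1r; apply: intUZ; rewrite ?rpredN ?rpred1.
  - rewrite sform lformZl lformZr mulrA e2 mul1r gform lformNr lform_f2 mkUE.
    by rewrite opprK.
have e2 : e * e = 1 by case: ee => ->; ring.
have s1I : lat_iso (act s1) := act_iso Htn s1S.
pose y := act s1 (g f2).
have [_ gform _] := gI; have [_ s1form _] := s1I.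
have y2 : lc2 y = e.
  have := s1form (g f2) (g f1); rewrite gform -/y s1f lformZr !lform_f1 mkUE => h.
  have {}h : e * lc2 y = 1 by move: h; lra.
  by rewrite -[lc2 y]mul1r -e2 -mulrA h mulr1.
have y1 : kappa y.1 y.1 = 2 * (e * lc1 y).
  have : K y y = 0 by rewrite s1form gform lform_f2 mkUE oppr0.
  by rewrite /lform y2; lra.
have yi : intU y.
  apply: (lat_iso_int s1I); apply: (lat_iso_int gI).
  by apply: intU_mk; rewrite ?rpred0 ?rpred1 //; apply: intv0.
have ei : - e \is a Num.int by rewrite rpredN; case: ee => ->; rewrite ?rpredN rpred1.
(* As [lc2 y = e] and [e * e = 1], the transvection along [- e *: y.1] cancels the finite part of
   [y]; isotropy then makes the first plane coordinate vanish. *)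
have [s2 s2S s2E] : in_weyl t (trans t (- e *: y.1)).
  by apply: trans_weyl => //; apply: intvZ => //; case: yi.
have s2f1 : act s2 (e *: f1) = e *: f1.
  by rewrite -s2E; apply: U_ext; rewrite /trans !UE ?kappa0l ?scaler0 ?mulr0 ?scale0r ?addr0 ?add0r ?kappaZl ?kappa0l ?mulr0 ?addr0.
have s2f2 : act s2 y = e *: f2.
  rewrite -s2E; apply: U_ext; rewrite /trans !UE y2.
  - by rewrite scalerA mulrN e2 scaleN1r subrr scaler0.
  - rewrite !kappaZr !kappaZl y1.
    have -> : lc1 y + - e * (2 * (e * lc1 y)) + - e * (- e * (2 * (e * lc1 y))) / 2 * e
       = lc1 y * (1 - 2 * (e * e) + (e * e) * (e * e)) by field.
    by rewrite e2; ring.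
  - by rewrite mulr1.
pose h1 x := act (s2 ++ s1) (g x).
have h1I : lat_iso h1 by apply: (lat_iso_comp (act_iso Htn (words_cat s2S s1S)) gI).
have h1f1 : h1 f1 = e *: f1 by rewrite /h1 act_cat s1f.
have h1f2 : h1 f2 = e *: f2 by rewrite /h1 act_cat.
have rd := rho_dual Htn.
have [||s3 [s3S s3f1 s3f2 s3d]] := @fin_descent (fin_part h1 rho).
- exact: fin_part_dual.
- exact: (fin_part_kappa e2 h1I h1f1 h1f2).
pose s := s3 ++ s2 ++ s1.
have sS : words simpleU s by do 2?apply: words_cat.
exists s => //.
pose h x := act s (g x); pose h' x := g' (act (rev s) x).
have hE x : h x = act s3 (h1 x) by rewrite /h /s act_cat.
have s3I := act_iso Htn s3S.
have hI : lat_iso h by apply: (lat_iso_comp (act_iso Htn sS) gI).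
have h'I : lat_iso h' by apply: (lat_iso_comp g'I (act_iso Htn (words_rev sS))).
have hK : cancel h h'.
  by move=> x; rewrite /h /h' (act_rev (simpleU_norm Htn) sS) gK.
have h'K : cancel h' h.
  move=> x; rewrite /h /h' g'K -{1}[s]revK (act_rev (simpleU_norm Htn)) //.
  exact: words_rev.
have hf1 : h f1 = e *: f1 by rewrite hE h1f1 (lat_isoZ _ _ s3I) s3f1.
have hf2 : h f2 = e *: f2 by rewrite hE h1f2 (lat_isoZ _ _ s3I) s3f2.
have [h'f1 h'f2] := plane_inv e2 hf1 hf2 hK h'I.
have fix_alpha : forall i, fin_part h (alpha i) = alpha i.
  apply: (finite_rigid e2 hI h'I h'K hf1 hf2 h'f1 h'f2) => i.
  by rewrite /fin_part hE (fix_plane_mk e2 h1I h1f1 h1f2); apply: s3d.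
have := fix_simple e2 hI hf1 hf2 fix_alpha.
case: ee => -> hx; [left|right] => x; rewrite -/(h x) hx.
  by rewrite !mul1r -mkU_eta.
by rewrite !mulN1r.
Qed.

End LorentzClassification.

(** * The Vahlen group *)

Lemma inv_unique (R : unitRingType) (x y : R) : x * y = 1 -> y * x = 1 ->
  x \is a GRing.unit /\ x^-1 = y.
Proof.
move=> xy yx; have xu : x \is a GRing.unit by apply/unitrP; exists y.
by split=> //; apply: (mulrI xu); rewrite xy mulrV.
Qed.

Section CliffordGroup.
Variables (F : fieldType) (V : vectType F) (S : {symmetric V}).
Local Notation C := (clifford S).
Local Notation i := (cl_iota S).

Lemma clifford_group1 : clifford_group (1 : C).
Proof.
split=> [|v]; first exact: unitr1.
by exists v; rewrite rmorph1 invr1 mul1r mulr1.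
Qed.

Lemma clifford_groupN1 : clifford_group (-1 : C).
Proof.
split=> [|v]; first exact: unitrN1.
by exists v; rewrite rmorphN1 invrN1 mulN1r mulrN1 opprK.
Qed.

Lemma clifford_groupM (x y : C) :
  clifford_group x -> clifford_group y -> clifford_group (x * y).
Proof.
move=> [xu xV] [yu yV]; split=> [|v]; first by rewrite unitrMl.
have [w vw] := yV v; have [u wu] := xV w; exists u.
rewrite rmorphM /= invrM ?rmorph_unit // -wu -vw !mulrA; congr (_ * _).
Qed.

(** The Clifford group only asks that twisted conjugation map [V] into itself. It is linear and
    injective there, so finite dimension makes it onto, as closure under inverses requires. *)
Lemma clifford_group_onto (x : C) : clifford_group x ->
  forall w, exists v, x * i v * (cl_prime x)^-1 = i w.
Proof.
move=> [xu xV]; have [f fE] := choice xV.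
have x'u : cl_prime x \is a GRing.unit by apply: rmorph_unit.
have fl : linear f.
  move=> a u v; apply: (@cl_iota_inj _ _ S).
  by rewrite -fE !linearP /= mulrDr mulrDl -scalerAr -scalerAl !fE.
pose fL : {linear V -> V} := HB.pack f (GRing.isLinear.Build F V V _ f fl).
have k0 : lker (linfun fL) == 0%VS.
  apply/lker0P => u v; rewrite !lfunE /= => /(congr1 i); rewrite -!fE.
  move=> /(mulIr (_ : (cl_prime x)^-1 \is a GRing.unit)); rewrite unitrV => /(_ x'u).
  by move=> /(mulrI xu)/cl_iota_inj.
move=> w; exists ((linfun fL)^-1%VF w); rewrite fE.
have := lker0_lfunVK k0 w; rewrite lfunE /= => -> //.
Qed.

Lemma clifford_groupV (x : C) : clifford_group x -> clifford_group x^-1.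
Proof.
move=> xG; have [xu _] := xG; split=> [|w]; first by rewrite unitrV.
have x'u : cl_prime x \is a GRing.unit by apply: rmorph_unit.
have [v <-] := clifford_group_onto xG w; exists v.
by rewrite rmorphV //= invrK !mulrA mulVr // mul1r mulrVK.
Qed.

Lemma clifford_group_iota r : S r r = 1 -> clifford_group (i r).
Proof.
move=> r1; have [ru rV] : i r \is a GRing.unit /\ (i r)^-1 = - i r.
  by apply: inv_unique; rewrite ?mulrN ?mulNr cl_iota_sqr r1 scale1r opprK.
split=> // v; exists (v - (2 * S v r) *: r).
rewrite cl_prime_iota invrN rV opprK; apply: clifford_map_reflection => //.
exact: cl_iota_sqr.
Qed.

End CliffordGroup.

Section Vahlen.
Variables (V : vectType rat) (S : {symmetric V}).
Local Notation CV := (clifford S).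
Local Notation M := (M2 CV).
Local Notation U := (vahlen_space V).
Local Notation Q := (vahlen_form S).
Local Notation phiv := (@phi_vec V S).
Implicit Types A B : M.

Lemma M2_alg_inj (a b : rat) : a%:A = b%:A :> M -> a = b.
Proof. exact: (fmorph_inj (in_alg M)). Qed.

Lemma phi_vecE x : phiv x = mx2 (cl_iota S x.1) (x.2 0 0)%:A (x.2 0 1)%:A (- cl_iota S x.1).
Proof. by rewrite /phi_vec cl_bar_iota. Qed.

Lemma phi_vec_inj : injective phiv.
Proof.
move=> [u a] [v b]; rewrite !phi_vecE /= => e.
have := congr1 (fun X : M => X 0 0) e; have := congr1 (fun X : M => X 0 1) e.
have := congr1 (fun X : M => X 1 0) e; rewrite !mx2E.
move=> /cl_alg_inj e1 /cl_alg_inj e0 /cl_iota_inj ->; congr pair.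
by apply/rowP => i; case: (ord2 i) => ->.
Qed.

Lemma phi_vec_h2 x : phiv x \in @h2_set V S.
Proof. by apply/asboolP; exists x; rewrite phi_iota. Qed.

Definition h2_of x : h2 S := MkH2 (phi_vec_h2 x).

Lemma h2_of_onto (X : h2 S) : exists x, X = h2_of x.
Proof.
case: X => X Xp; have /asboolP[w e] := Xp; exists w; apply: val_inj.
by rewrite /= e phi_iota.
Qed.

Definition h2_coord (X : h2 S) : U := projT1 (cid (h2_of_onto X)).

Lemma h2_coordK : cancel h2_coord h2_of.
Proof. by move=> X; rewrite /h2_coord; case: cid. Qed.

Lemma h2_of_inj : injective h2_of.
Proof. by move=> x y /(congr1 val)/= /phi_vec_inj. Qed.

Lemma h2_ofK : cancel h2_of h2_coord.
Proof. by move=> x; apply: h2_of_inj; rewrite h2_coordK. Qed.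

Definition h2_lift (f : U -> U) (X : h2 S) : h2 S := h2_of (f (h2_coord X)).

Lemma h2_lift_id : h2_lift id = id.
Proof. by apply/funext => X; apply: h2_coordK. Qed.

Lemma h2_lift_comp (f g : U -> U) : h2_lift (f \o g) = h2_lift f \o h2_lift g.
Proof. by apply/funext => X; rewrite /h2_lift /= h2_ofK. Qed.

Lemma h2_ofD x y : h2_of (x + y) = h2_of x + h2_of y.
Proof. by apply: val_inj; rewrite /= linearD. Qed.

Lemma h2_ofZ a x : h2_of (a *: x) = a *: h2_of x.
Proof. by apply: val_inj; rewrite /= linearZ. Qed.

Lemma h2_quad_of x : h2_quad (h2_of x) = Q x x.
Proof.
apply: (@cl_alg_inj rat V S); rewrite h2_quadE /= phi_vecE !mx2E cl_bar_iota mulrN cl_iota_sqr opprK.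
rewrite -scalerAl mul1r scalerA -scalerBl.
by congr (_ *: _); rewrite /osum /= /hplane_form /=; field.
Qed.

Lemma vahlen_formC x y : Q x y = Q y x.
Proof. by rewrite (hermC Q x y) /= expr0 mul1r. Qed.

Lemma h2_form_of x y : h2_form (h2_of x) (h2_of y) = Q x y.
Proof.
rewrite /h2_form -h2_ofD !h2_quad_of linearDl /= !linearDr /= (vahlen_formC y x).
by rewrite /=; field.
Qed.

Lemma h2_of_reflection x y :
  h2_of (reflection Q x y) = reflection (@h2_form V S) (h2_of x) (h2_of y).
Proof.
by rewrite /reflection !h2_form_of -scaleNr h2_ofD h2_ofZ scaleNr.
Qed.

Lemma vahlen_alpha_phi_vec x : vahlen_alpha (phiv x) = - phiv x.
Proof. by rewrite -phi_iota vahlen_alpha_phi cl_prime_iota rmorphN. Qed.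

Lemma vahlen_gamma_phi_vec x : vahlen_gamma (phiv x) = - phiv x.
Proof.
rewrite phi_vecE /vahlen_gamma !mx2E; apply: M2P; rewrite M2_oppE !mx2E.
- by rewrite linearN /= cl_star_iota.
- by rewrite linearZ /= cl_star1.
- by rewrite linearZ /= cl_star1.
- by rewrite cl_star_iota opprK.
Qed.

Lemma vahlen1 : vahlen (1 : M).
Proof. by exists 1; [exact: clifford_group1|rewrite rmorph1]. Qed.

Lemma vahlenN1 : vahlen (-1 : M).
Proof. by exists (-1); [exact: clifford_groupN1|rewrite rmorphN1]. Qed.

Lemma vahlenM A B : vahlen A -> vahlen B -> vahlen (A * B).
Proof.
move=> [x xG ->] [y yG ->]; exists (x * y); first exact: clifford_groupM.
by rewrite rmorphM.
Qed.

Lemma vahlenV A : vahlen A -> vahlen A^-1.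
Proof.
move=> [x xG ->]; exists x^-1; first exact: clifford_groupV.
by rewrite rmorphV //; case: xG.
Qed.

Lemma vahlen_phi_vec r : Q r r = 1 -> vahlen (phiv r).
Proof.
by move=> r1; exists (cl_iota Q r); [exact: clifford_group_iota|rewrite phi_iota].
Qed.

Lemma vahlen_unit A : vahlen A -> A \is a GRing.unit.
Proof. by move=> [x [xu _] ->]; apply: rmorph_unit. Qed.

Lemma vahlen_alpha_unit A : A \is a GRing.unit -> vahlen_alpha A \is a GRing.unit.
Proof.
move=> Au; apply/unitrP; exists (vahlen_alpha A^-1).
by rewrite -!vahlen_alphaM mulVr // mulrV // vahlen_alpha1.
Qed.

Lemma vahlen_alphaV A : A \is a GRing.unit -> (vahlen_alpha A)^-1 = vahlen_alpha A^-1.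
Proof.
move=> Au; apply: (mulrI (vahlen_alpha_unit Au)).
by rewrite mulrV ?vahlen_alpha_unit // -vahlen_alphaM mulrV // vahlen_alpha1.
Qed.

Lemma vahlen_plusV A : vahlen_plus A -> A^-1 = vahlen_gamma A.
Proof.
move=> [Av AN]; have Au := vahlen_unit Av.
by apply: (mulrI Au); rewrite mulrV // -[RHS]AN.
Qed.

Lemma vahlen_plus1 : vahlen_plus (1 : M).
Proof. by split; [exact: vahlen1|rewrite /vahlen_norm vahlen_gamma1 mulr1]. Qed.

Lemma vahlen_plusM A B : vahlen_plus A -> vahlen_plus B -> vahlen_plus (A * B).
Proof.
move=> [Av AN] [Bv BN]; split; first exact: vahlenM.
by rewrite /vahlen_norm vahlen_gammaM mulrA -(mulrA A) [B * _]BN mulr1.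
Qed.

Lemma vahlen_plus_inv A : vahlen_plus A -> vahlen_plus A^-1.
Proof.
move=> Ap; have [Av AN] := Ap; split; first exact: vahlenV.
rewrite /vahlen_norm (vahlen_plusV Ap) vahlen_gammaK -(vahlen_plusV Ap).
by rewrite mulVr // vahlen_unit.
Qed.

Lemma vahlen_plusN1 : vahlen_plus (-1 : M).
Proof.
split; first exact: vahlenN1.
by rewrite /vahlen_norm vahlen_gammaN vahlen_gamma1 mulrNN mulr1.
Qed.

Lemma vahlen_plus_phi_vec r : Q r r = 1 -> vahlen_plus (phiv r).
Proof.
move=> r1; split; first exact: vahlen_phi_vec.
by rewrite /vahlen_norm vahlen_gamma_phi_vec mulrN phi_vec_sqr r1 scale1r opprK.
Qed.

Lemma eta_comp A B : vahlen A -> vahlen B -> eta (A * B) = eta A \o eta B.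
Proof.
move=> Av Bv; apply/funext => X; apply: val_inj => /=.
rewrite (etaE _ (vahlenM Av Bv)) (etaE _ Av) (etaE _ Bv).
rewrite vahlen_alphaM invrM ?vahlen_alpha_unit ?vahlen_unit //.
by rewrite !mulrA.
Qed.

Lemma eta1 : eta (1 : M) = id.
Proof.
apply/funext => X; apply: val_inj; rewrite /= etaE; last exact: vahlen1.
by rewrite vahlen_alpha1 invr1 mul1r mulr1.
Qed.

Lemma etaN A : vahlen A -> eta (- A) = eta A.
Proof.
move=> Av; rewrite -mulN1r eta_comp //; last exact: vahlenN1.
apply/funext => X /=; apply: val_inj; rewrite /= etaE; last exact: vahlenN1.
by rewrite vahlen_alphaN vahlen_alpha1 invrN1 mulN1r mulrN1 opprK.
Qed.

Lemma eta_phi_vec r x : Q r r = 1 ->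
  eta (phiv r) (h2_of x) = h2_of (x - (2 * Q x r) *: r).
Proof.
move=> r1; apply: val_inj; rewrite /= etaE; last exact: vahlen_phi_vec.
rewrite -(clifford_map_reflection (@phi_vec_sqr V S)) // vahlen_alpha_phi_vec.
have [_ ->] : - phiv r \is a GRing.unit /\ (- phiv r)^-1 = phiv r; last by [].
by apply: inv_unique; rewrite ?mulNr ?mulrN phi_vec_sqr r1 scale1r opprK.
Qed.

Definition eta_coord A x : U := h2_coord (eta A (h2_of x)).

Lemma eta_coordE A x : vahlen A ->
  phiv (eta_coord A x) = A * phiv x * (vahlen_alpha A)^-1.
Proof.
move=> Av; rewrite -[phiv (eta_coord A x)]/(h2_val (h2_of _)) h2_coordK.
by rewrite etaE.
Qed.

Lemma eta_coord_linear A : vahlen A -> linear (eta_coord A).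
Proof.
move=> Av a x y; apply: phi_vec_inj; rewrite linearP /= !eta_coordE //.
by rewrite linearP /= mulrDr mulrDl -scalerAr -scalerAl.
Qed.

Lemma eta_coord_form A x y : vahlen A -> Q (eta_coord A x) (eta_coord A y) = Q x y.
Proof.
move=> Av; have Au := vahlen_unit Av.
have quad z : Q (eta_coord A z) (eta_coord A z) = Q z z.
  apply: oppr_inj; apply: M2_alg_inj; rewrite !scaleNr -!(phi_vec_sqr S).
  (* Applying alpha to the defining formula gives a second one with [A] and [vahlen_alpha A]
     exchanged. In the product of the two the inner factors cancel, leaving the conjugate of a
     scalar. *)
  have e : phiv (eta_coord A z) = vahlen_alpha A * phiv z * A^-1.
    have := congr1 (@vahlen_alpha V S) (eta_coordE z Av).
    rewrite !vahlen_alphaM !vahlen_alpha_phi_vec vahlen_alphaV // vahlen_alphaK.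
    by rewrite mulrN mulNr => /oppr_inj.
  rewrite {1}eta_coordE // e -!mulrA mulKr ?vahlen_alpha_unit //.
  rewrite (mulrA (phiv z)) phi_vec_sqr -scaleNr mulr_algl -scalerAr mulrV //.
have := quad (x + y); rewrite -[x]scale1r eta_coord_linear // !scale1r.
rewrite !linearDl /= !linearDr /= !quad (vahlen_formC y x) (vahlen_formC (eta_coord A y)).
by rewrite /=; lra.
Qed.

End Vahlen.

(** * Identification of the highest root *)

Section Theta.
Variables (t : ade) (n : nat).
Hypothesis Htn : listed_type t n.
Local Notation V := 'rV[rat]_n.
Local Notation alpha := (@simple_root n).
Local Notation kappa := (@Defs.kappa t n).
Local Notation theta0 := (marks t n).

Lemma simple_reflectionE i (v : V) :
  reflection kappa (alpha i) v = v - kappa v (alpha i) *: alpha i.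
Proof. by rewrite /reflection kappa_simple2 cartan_diag mulrC divfK. Qed.

Lemma finite_weyl_iso (w : V -> V) :
  generated_group (@finite_simple_reflection t n) w ->
  forall u v, kappa (w u) (w v) = kappa u v.
Proof.
elim=> {w} [_ [i] u v|//|f g _ hf _ hg u v|f g _ hf fK gK u v].
- rewrite !simple_reflectionE kappaBl !kappaBr !kappaZl !kappaZr kappa_simple2.
  by rewrite cartan_diag (kappaC t (alpha i) v); ring.
- by rewrite /= hf hg.
- by rewrite -hf !gK.
Qed.

Lemma root_norm (b : V) : Defs.root t b -> kappa b b = 2.
Proof.
by move=> [w [i [wW ->]]]; rewrite finite_weyl_iso // kappa_simple2 cartan_diag.
Qed.

Lemma root_marks : Defs.root t theta0.
Proof.
have i0 : 'I_n by case: n Htn => [|m] Hm; [case: (t) Hm|exact: ord0].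
have [|+ _] := marks_orbit Htn (P := @Defs.root t n) _ i0; last first.
  by apply; exists id, i0; split=> //; apply: gen_id.
move=> i v [w [j [wW ->]]].
exists (reflection kappa (alpha i) \o w), j; split.
  by apply: gen_comp wW; apply: gen_in.
by rewrite /= simple_reflectionE.
Qed.

(** The difference [g = theta - theta0] has nonnegative coefficients, because [theta0] is a root.
    Both norms are 2, so [2 * kappa theta0 g + kappa g g = 0]; both terms are nonnegative, since
    [theta0] is dominant, and [g] vanishes. *)
Lemma highest_root_marks (theta : V) : highest_root t theta -> theta = theta0.
Proof.
move=> [tR th]; pose g := theta - theta0.
have g0 i : 0 <= g 0 i.
  have -> : g 0 i = theta 0 i - theta0 0 i.
    by rewrite [LHS]mxE; congr (_ + _); rewrite [LHS]mxE.
  by rewrite subr_ge0; apply: th; apply: root_marks.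
have tE : theta = theta0 + g by rewrite addrC subrK.
clearbody g.
have mg : 0 <= kappa theta0 g.
  by rewrite kappa_coord sumr_ge0 // => i _; rewrite mulr_ge0 // marks_dominant.
have := root_norm tR; rewrite tE kappaDl !kappaDr (kappaC t g theta0) (root_norm root_marks).
move=> e; suff -> : g = 0 by rewrite addr0.
by have k0 := kappa_ge0 Htn g; apply: (kappa_eq0 Htn); lra.
Qed.

End Theta.

(** * Integral Vahlen matrices as lattice isometries *)

Section VahlenOrder.
Variables (t : ade) (n : nat).
Hypothesis Htn : listed_type t n.
Local Notation V := 'rV[rat]_n.
Local Notation S := (@half_form t n : {symmetric V}).
Local Notation CV := (clifford S).
Local Notation M := (M2 CV).
Local Notation iV := (cl_iota S).
Local Notation C := (cartan t n).
Local Notation G := (weight_gram t n).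
Local Notation K := (@lform t n).
Local Notation Q := (vahlen_form S).
Local Notation phiv := (@phi_vec V S).
Local Notation order := (@Defs.order t n).
Local Notation VO := (@vahlen_plus_order t n).
Local Notation order_M2 := (@Defs.order_M2 t n).
Implicit Types A B : M.

Let GC : G *m C = 1%:M := weight_gram_cartan Htn.

Lemma lform_vahlen x y : K x y = 2 * Q x y.
Proof.
by rewrite /lform -kappa_half /= /osum /= /hplane_form /lc1 /lc2; field.
Qed.

Lemma refl_vahlen X x : Q X X = 1 -> lor_refl t X x = reflection Q X x.
Proof. by move=> X1; rewrite /lor_refl /reflection X1 divr1 lform_vahlen. Qed.

Lemma order_M2M A B : order_M2 A -> order_M2 B -> order_M2 (A * B).
Proof.
move=> Ao Bo i j; rewrite M2_mulE.
by apply: gen_ring_add; apply: gen_ring_mul; [exact: Ao|exact: Bo|exact: Ao|exact: Bo].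
Qed.

Lemma order_M2_mx a b c d : order a -> order b -> order c -> order d ->
  order_M2 (mx2 a b c d).
Proof. by move=> *; move=> i j; case: (ord2 i) => ->; case: (ord2 j) => ->; rewrite mx2E. Qed.

Lemma order_M2_gamma A : order_M2 A -> order_M2 (vahlen_gamma A).
Proof.
move=> Ao; apply: order_M2_mx; try apply: gen_ring_opp; exact: order_star (Ao _ _).
Qed.

Lemma order_M2_alpha A : order_M2 A -> order_M2 (vahlen_alpha A).
Proof.
move=> Ao; apply: order_M2_mx; try apply: gen_ring_opp; exact: order_prime (Ao _ _).
Qed.

(* The norm condition makes [vahlen_gamma A] the inverse of [A], so membership
   in GL_2(O) only depends on the entries. *)
Lemma vahlen_plus_orderP A : VO A <-> vahlen_plus A /\ order_M2 A.
Proof.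
split=> [[Ap [Ao _]]//|[Ap Ao]]; split=> //; split=> //.
have Au := vahlen_unit Ap.1; exists (vahlen_gamma A); split.
- exact: order_M2_gamma.
- exact: Ap.2.
- by rewrite -(vahlen_plusV Ap) mulVr.
Qed.

Lemma vahlen_plus_order1 : VO 1.
Proof.
apply/vahlen_plus_orderP; split; first exact: vahlen_plus1.
rewrite M2_1E; apply: order_M2_mx; by [exact: gen_ring_1|exact: gen_ring_0].
Qed.

Lemma vahlen_plus_orderN1 : VO (-1).
Proof.
apply/vahlen_plus_orderP; split; first exact: vahlen_plusN1.
move=> i j; rewrite M2_oppE; apply: gen_ring_opp.
by have /vahlen_plus_orderP[_] := vahlen_plus_order1; apply.
Qed.

Lemma vahlen_plus_orderM A B : VO A -> VO B -> VO (A * B).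
Proof.
move=> /vahlen_plus_orderP[Ap Ao] /vahlen_plus_orderP[Bp Bo].
apply/vahlen_plus_orderP; split; first exact: vahlen_plusM.
exact: order_M2M.
Qed.

Lemma vahlen_plus_orderV A : VO A -> VO A^-1.
Proof.
move=> /vahlen_plus_orderP[Ap Ao].
apply/vahlen_plus_orderP; split; first exact: vahlen_plus_inv.
by rewrite (vahlen_plusV Ap); apply: order_M2_gamma.
Qed.

Lemma order_phi_vec x : order_M2 (phiv x) <-> intU x.
Proof.
rewrite phi_vecE; split=> [h|[x1 xa xb]].
  by split; [apply/(order_iotaP GC); have := h 0 0; rewrite mx2E
    |apply: (order_scalar GC); have := h 0 1; rewrite mx2E
    |apply: (order_scalar GC); have := h 1 0; rewrite mx2E].
apply: order_M2_mx; try apply: gen_ring_opp; try exact: order_iota.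
all: exact: gen_ring_alg.
Qed.

(* The entries of [A Y - Y alpha(A)] are, up to integral terms, twisted
   derivatives [x v - v x'] of the entries of [A]; they stay in the order when
   [v] is in the dual lattice, whence the triviality on the discriminant
   group. *)
Lemma eta_coord_iso A : VO A -> lor_iso t (eta_coord A).
Proof.
move=> /vahlen_plus_orderP[Ap Ao]; have Av := Ap.1; split.
- exact: eta_coord_linear.
- by move=> x y; rewrite !lform_vahlen eta_coord_form.
move=> y [yd y1 y2]; apply/order_phi_vec.
have Au := vahlen_unit Av.
have -> : phiv (eta_coord A y - y) =
    (A * phiv y - phiv y * vahlen_alpha A) * vahlen_alpha (vahlen_gamma A).
  have -> : vahlen_alpha (vahlen_gamma A) = (vahlen_alpha A)^-1.
    by rewrite vahlen_alphaV // (vahlen_plusV Ap).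
  by rewrite linearB /= (eta_coordE y Av) mulrBl (mulrK (vahlen_alpha_unit Au)).
apply: order_M2M; last exact/order_M2_alpha/order_M2_gamma.
rewrite phi_vecE [A in A * _]mx2_eta /vahlen_alpha.
set v := iV y.1; set p := y.2 0 0; set q := y.2 0 1.
pose a := A 0 0; pose b := A 0 1; pose c := A 1 0; pose d := A 1 1.
rewrite -/a -/b -/c -/d.
have [ao bo co d_o] : [/\ order a, order b, order c & order d] by split; apply: Ao.
have D x : order x -> order (x * v - v * cl_prime x) by exact: order_der.
have sZ (k : rat) x : k \is a Num.int -> order x -> order (k *: x) by exact: gen_ring_int.
have pr x : order x -> order (cl_prime x) by exact: order_prime.
have [oD oB oN] : [/\ forall x y, order x -> order y -> order (x + y),
    forall x y, order x -> order y -> order (x - y) & forall x, order x -> order (- x)].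
  by split; [exact: gen_ring_add|exact: gen_ring_sub|exact: gen_ring_opp].
have sub_mx2 (a1 b1 c1 d1 a2 b2 c2 d2 : CV) : mx2 a1 b1 c1 d1 - mx2 a2 b2 c2 d2
    = mx2 (a1 - a2) (b1 - b2) (c1 - c2) (d1 - d2).
  by apply: M2P; rewrite M2_addE M2_oppE !mx2E.
rewrite !mul_mx2 sub_mx2 !mulr_algl !mulr_algr !mulrN !mulNr.
apply: order_M2_mx.
- rewrite opprD addrACA scalerN opprK.
  by apply: (oD _ _ (D _ ao)); apply oD; apply sZ; auto.
- rewrite opprD opprK [v * _ - _]addrC addrACA [- (b * v) + _]addrC -(opprB (b * v)).
  by apply: (oB _ _ _ (D _ bo)); apply oB; apply sZ; auto.
- rewrite opprK opprD [- (q *: _) - _]addrC addrACA.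
  by apply: (oD _ _ (D _ co)); apply oB; apply sZ; auto.
- rewrite opprB scalerN opprK [v * _ + _]addrC addrACA [- (d * v) + _]addrC -(opprB (d * v)).
  by apply: (oB _ _ _ (D _ d_o)); apply oD; apply sZ; auto.
Qed.

End VahlenOrder.

(** * The isomorphism with the Weyl group *)

Section VahlenWeyl.
Variables (t : ade) (n : nat).
Hypothesis Htn : listed_type t n.
Local Notation V := 'rV[rat]_n.
Local Notation S := (@half_form t n : {symmetric V}).
Local Notation CV := (clifford S).
Local Notation M := (M2 CV).
Local Notation iV := (cl_iota S).
Local Notation alpha := (@simple_root n).
Local Notation C := (cartan t n).
Local Notation G := (weight_gram t n).
Local Notation Q := (vahlen_form S).
Local Notation phiv := (@phi_vec V S).
Local Notation VO := (@vahlen_plus_order t n).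
Implicit Types A B : M.

Let GC : G *m C = 1%:M := weight_gram_cartan Htn.
Local Notation theta0 := (marks t n).
Local Notation weyl := (@lorentz_weyl_group t n theta0).

(* Comparing entries in [A X = eta(A)(X) alpha(A)] for [X = f1, f2] and
   [X = v]: [A] is diagonal, with an entry [a] such that [a v = v a']. *)
Lemma eta_scalar A (e : rat) : VO A ->
  (forall x, eta_coord A x = mkU x.1 (e * lc1 x) (e * lc2 x)) ->
  e * e = 1 -> e = 1 /\ (A = 1 \/ A = -1).
Proof.
move=> /vahlen_plus_orderP[Ap _] h ee; have Av := Ap.1; have Au := vahlen_unit Av.
have AX x : A * phiv x = phiv (mkU x.1 (e * lc1 x) (e * lc2 x)) * vahlen_alpha A.
  by rewrite -(h x) (eta_coordE x Av) (mulrVK (vahlen_alpha_unit Au)).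
pose a := A 0 0; pose b := A 0 1; pose c := A 1 0; pose d := A 1 1.
have AE : A = mx2 a b c d := mx2_eta A.
have e0 : e != 0 by apply/eqP => e0; move: ee; rewrite e0 mul0r => /eqP; rewrite eq_sym oner_eq0.
have phiE v k l : phiv (mkU v k l) = mx2 (iV v) k%:A l%:A (- iV v).
  by rewrite phi_vecE -/(lc1 _) -/(lc2 _) !mkUE.
have c0 : c = 0.
  have := congr1 (fun X : M => X 1 1) (AX (mkU 0 1 0)).
  rewrite !mkUE !phiE linear0 !M2_mulE !mx2E -/c -/d.
  by rewrite oppr0 !mulr0 scale0r !mul0r scale1r mulr1 !addr0.
have b0 : b = 0.
  have := congr1 (fun X : M => X 0 0) (AX (mkU 0 0 1)).
  rewrite !mkUE !phiE linear0 !M2_mulE !mx2E -/a -/b.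
  by rewrite !mulr0 !scale0r scale1r mulr1 !mul0r !add0r.
have dE : d = e *: cl_prime a.
  have := congr1 (fun X : M => X 1 0) (AX (mkU 0 0 1)).
  rewrite !mkUE !phiE linear0 !M2_mulE !mx2E -/a -/c -/d.
  by rewrite !mulr0 scale1r !mulr1 oppr0 mul0r addr0 add0r mulr_algl.
have [k ak] : exists k : rat, a = k%:A.
  apply: (cl_der_eq0 GC) => v.
  have := congr1 (fun X : M => X 0 0) (AX (mkU v 0 0)).
  rewrite !mkUE !phiE !M2_mulE !mx2E -/a -/b -/c.
  rewrite !mulr0 !scale0r !mulr0 !mul0r !addr0 => av.
  by rewrite /cl_der av subrr.
have dk : d = (e * k)%:A by rewrite dE ak linearZ /= rmorph1 scalerA.
have AN := Ap.2; have := congr1 (fun X : M => X 0 0) AN.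
rewrite /vahlen_norm M2_mulE M2_1E /vahlen_gamma !mx2E -/a -/b -/c -/d b0 mul0r addr0.
rewrite ak dk linearZ /= cl_star1 -scalerAl mul1r scalerA -[X in _ = X -> _]scale1r.
move/cl_alg_inj => kek.
(* The norm condition has become [e k^2 = 1] with [k] rational, which is impossible for [e = -1]. *)
have e1 : e = 1 by have : (e - 1) * (e + 1) = 0 by [nra]; nra.
split=> //; have kk : (k - 1) * (k + 1) = 0 by move: kek; rewrite e1; lra.
rewrite AE b0 c0 ak dk e1 mul1r; move/eqP: kk; rewrite mulf_eq0 subr_eq0 addr_eq0.
case/orP=> /eqP ->; [left|right]; first by rewrite scale1r.
by apply: M2P; rewrite M2_oppE !mx2E ?scaleN1r ?oppr0.
Qed.

Lemma simpleU_vahlen X : lor_simple t X -> Q X X = 1.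
Proof. by move=> /(simpleU_norm Htn); rewrite lform_vahlen; lra. Qed.

Lemma simpleU_lorentz X : lor_simple t X -> @lorentz_root t n theta0 (phiv X).
Proof.
case=> [||i]; rewrite phi_vecE -/(lc1 _) -/(lc2 _) !mkUE.
- by rewrite linear0 oppr0 scale1r scaleN1r; apply: LorentzM1.
- rewrite linearN /= opprK scaleN1r scale0r.
  by have := @Lorentz0 t n theta0; rewrite cl_bar_iota opprK.
- by rewrite scale0r; have := @LorentzS t n theta0 i; rewrite cl_bar_iota.
Qed.

Lemma lorentz_simpleU (X : h2 S) : @lorentz_root t n theta0 (h2_val X) ->
  exists2 x, lor_simple t x & X = h2_of S x.
Proof.
move=> XR; suff [x xS e] : exists2 x, lor_simple t x & h2_val X = phiv x.
  by exists x => //; apply: val_inj.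
case: XR => [||i]; rewrite ?cl_bar_iota.
- exists (mkU 0 1 (-1)); first exact: SimpleM1.
  by rewrite phi_vecE -/(lc1 _) -/(lc2 _) !mkUE linear0 oppr0 scale1r scaleN1r.
- exists (mkU (- theta0) (-1) 0); first exact: Simple0.
  by rewrite phi_vecE -/(lc1 _) -/(lc2 _) !mkUE (linearN iV) scaleN1r scale0r.
- exists (mkU (alpha i) 0 0); first exact: SimpleS.
  by rewrite phi_vecE -/(lc1 _) -/(lc2 _) !mkUE scale0r.
Qed.

Lemma refl_weyl X : lor_simple t X ->
  weyl (@h2_lift V S (lor_refl t X)).
Proof.
move=> XS; apply: gen_in.
have -> : @h2_lift V S (lor_refl t X) = reflection (@h2_form V S) (h2_of S X).
  apply/funext => Y; rewrite /h2_lift refl_vahlen ?h2_of_reflection ?h2_coordK //.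
  exact: simpleU_vahlen.
by apply: LorentzReflection; apply: simpleU_lorentz.
Qed.

Lemma act_weyl s : words (@lor_simple t n) s ->
  weyl (@h2_lift V S (lor_act t s)).
Proof.
elim: s => [|X s IHs] sP.
  by rewrite (_ : lor_act t [::] = id) // h2_lift_id; apply: gen_id.
rewrite (_ : lor_act t (X :: s) = lor_refl t X \o lor_act t s) // h2_lift_comp.
apply: gen_comp; first by apply/refl_weyl/sP; rewrite mem_head.
by apply: IHs => Y Ys; apply: sP; rewrite inE Ys orbT.
Qed.

Lemma simpleU_order X : lor_simple t X -> VO (phiv X).
Proof.
move=> XS; apply/vahlen_plus_orderP; split.
  exact/vahlen_plus_phi_vec/simpleU_vahlen.
exact/order_phi_vec/(simpleU_int XS).
Qed.

(** A simple reflection is [eta] of its own root matrix, which has norm 1 and entries in O. *)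
Lemma weyl_onto (w : h2 S -> h2 S) : weyl w -> exists2 A, VO A & eta A = w.
Proof.
elim=> {w} [_ [X /lorentz_simpleU[x xS ->]]||f g _ [A AO <-] _ [B BO <-]|
  f g _ [A AO <-] fK gK].
- exists (phiv x); first exact: simpleU_order.
  apply/funext => Y; rewrite -[Y]h2_coordK eta_phi_vec; last exact: simpleU_vahlen.
  rewrite -h2_of_reflection -refl_vahlen; last exact: simpleU_vahlen.
  by rewrite /lor_refl lform_vahlen.
- by exists 1; [exact: vahlen_plus_order1|exact: eta1].
- exists (A * B); first exact: vahlen_plus_orderM.
  by rewrite eta_comp; [|exact: AO.1.1|exact: BO.1.1].
- exists A^-1; first exact: vahlen_plus_orderV.
  have Av := AO.1.1; apply/funext => X; rewrite -{1}[X]gK.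
  have := congr1 (fun f => f (g X)) (eta_comp (vahlenV Av) Av).
  by rewrite mulVr ?vahlen_unit // eta1 => /esym.
Qed.

Lemma vahlen_plus_order_weyl A : VO A -> weyl (eta A).
Proof.
move=> AO; have Av := AO.1.1; have A'O := vahlen_plus_orderV AO; have A'v := A'O.1.1.
have Au := vahlen_unit Av.
have cK B : vahlen B -> vahlen B^-1 -> cancel (eta_coord B) (eta_coord B^-1).
  move=> Bv B'v x; rewrite /eta_coord h2_coordK.
  have := congr1 (fun f => f (h2_of S x)) (eta_comp B'v Bv).
  by rewrite mulVr ?vahlen_unit // eta1 /= => <-; rewrite h2_ofK.
have gK := cK A Av A'v; have g'K : cancel (eta_coord A^-1) (eta_coord A).
  by have := cK A^-1 A'v; rewrite invrK; apply.
have [s sS sE] := lattice_weyl Htn (eta_coord_iso Htn AO) (eta_coord_iso Htn A'O) gK g'K.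
have [B BO BE] := weyl_onto (act_weyl sS).
have Bv := BO.1.1.
have BA x : eta_coord (B * A) x = lor_act t s (eta_coord A x).
  by rewrite /eta_coord eta_comp //= BE h2_ofK.
have BAO := vahlen_plus_orderM BO AO.
(* The word [s] has been lifted to a matrix [B], so the sign alternative would make [B * A] an
   element of V^+(O) acting as -1 on the plane and trivially on [V], which [eta_scalar] rules
   out. *)
case: sE => sE; last first.
  have [||/eqP] := eta_scalar (e := -1) BAO.
  - by move=> x; rewrite BA sE !mulN1r.
  - by ring.
  by rewrite -subr_eq0; case/negP; rewrite (_ : -1 - 1 = - 2%:R) ?oppr_eq0 ?pnatr_eq0 //; ring.
have -> : eta A = @h2_lift V S (lor_act t (rev s)).
  apply/funext => Y; rewrite -[eta A Y]h2_coordK; congr (h2_of S).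
  have h := sE (h2_coord Y); rewrite /eta_coord h2_coordK in h.
  by rewrite -h (act_rev (simpleU_norm Htn) sS).
by apply: act_weyl; apply: words_rev.
Qed.

Lemma eta_injective A B : VO A -> VO B -> eta A = eta B -> A = B \/ A = - B.
Proof.
move=> AO BO e; have Av := AO.1.1; have Bv := BO.1.1.
have B'O := vahlen_plus_orderV BO; have Bu := vahlen_unit Bv.
have [||_] := @eta_scalar (B^-1 * A) 1 (vahlen_plus_orderM B'O AO).
- move=> x; rewrite !mul1r -mkU_eta /eta_coord (eta_comp B'O.1.1 Av) e.
  by rewrite -(eta_comp B'O.1.1 Bv) (mulVr Bu) eta1 h2_ofK.
- by rewrite mul1r.
case=> /(congr1 (fun X => B * X)); rewrite (mulVKr Bu); [left|right].
  by rewrite -[RHS]mulr1.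
by rewrite -mulrN1.
Qed.

End VahlenWeyl.

(* The first conjunct says that V^+(O) is a group containing -1; the others say
   that eta is a group morphism from it to W(C^++), that its fibres are exactly
   the classes {A, -A}, and that it is onto. *)
Theorem theorem6p5 (t : ade) (n : nat) (Htn : listed_type t n)
    (theta : 'rV[rat]_n) (Htheta : highest_root t theta) :
  [/\ [/\ @vahlen_plus_order t n 1,
          @vahlen_plus_order t n (-1),
          forall A B : M2 (clifford (@half_form t n)),
            vahlen_plus_order A -> vahlen_plus_order B ->
            vahlen_plus_order (A * B)
        & forall A : M2 (clifford (@half_form t n)),
            vahlen_plus_order A ->
            A \is a GRing.unit /\ vahlen_plus_order A^-1],
      forall A : M2 (clifford (@half_form t n)),
        vahlen_plus_order A -> lorentz_weyl_group theta (eta A),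
      forall A B : M2 (clifford (@half_form t n)),
        vahlen_plus_order A -> vahlen_plus_order B ->
        eta (A * B) = eta A \o eta B,
      forall A B : M2 (clifford (@half_form t n)),
        vahlen_plus_order A -> vahlen_plus_order B ->
        (eta A = eta B <-> A = B \/ A = - B)
    & forall w : h2 (@half_form t n) -> h2 (@half_form t n),
        lorentz_weyl_group theta w ->
        exists2 A : M2 (clifford (@half_form t n)),
          vahlen_plus_order A & eta A = w].
Proof.
have -> : theta = marks t n := highest_root_marks Htn Htheta.
split.
- split; [exact: vahlen_plus_order1|exact: vahlen_plus_orderN1|exact: vahlen_plus_orderM|].
  move=> A AO; split; first exact: (vahlen_unit AO.1.1).
  exact: vahlen_plus_orderV.
- exact: vahlen_plus_order_weyl.
- by move=> A B AO BO; apply: (eta_comp AO.1.1 BO.1.1).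
- move=> A B AO BO; split=> [|[->//|->]]; first exact: eta_injective.
  exact: (etaN BO.1.1).
- exact: weyl_onto.
Qed.
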